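(* Let $\vartheta$ be a non-degenerate symmetric bivector field on a smooth manifold $M$, and let $\nabla$ be a torsion-free connection on $M$. Then $(\vartheta,\nabla)$ is a strong symmetric Poisson structure if and only if $\nabla$ is the Levi-Civita connection of $\vartheta^{-1}$. Consequently, the assignment $(\vartheta,\nabla)\mapsto\vartheta^{-1}$ gives a bijection between non-degenerate strong symmetric Poisson structures on $M$ and (pseudo-)Riemannian metrics on $M$.
   Context: A symmetric bivector field $\vartheta\in\Gamma(\mathrm{Sym}^2TM)$ is viewed as a map $T^*M\to TM$, $\beta(\vartheta(\alpha))=\vartheta(\alpha,\beta)$; it is non-degenerate if this map is an isomorphism, and then $\vartheta^{-1}:TM\to T^*M$ is regarded as a non-degenerate symmetric $2$-form, i.e. a (pseudo-)Riemannian metric. Put $\{f,h\}:=\vartheta(\mathrm{d}f,\mathrm{d}h)$, $X_f:=\vartheta(\mathrm{d}f)$, and for a torsion-free connection $\nabla$ put $[X,Y]_s:=\nabla_XY+\nabla_YX$ for vector fields. The pair $(\vartheta,\nabla)$ is a strong symmetric Poisson structure if $X_{\{f,h\}}=[X_f,X_h]_s$ for all $f,h\in C^\infty(M)$. *)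

(* Defs.v *)
From HB Require Import structures.
From mathcomp Require Import all_boot all_order all_algebra.
From mathcomp Require Import all_classical all_reals all_analysis.
Set Implicit Arguments.
Unset Strict Implicit.
Unset Printing Implicit Defensive.
Import Order.TTheory GRing.Theory Num.Theory.
Import numFieldNormedType.Exports.
Local Open Scope classical_set_scope.
Local Open Scope ring_scope.

Section SmoothOn.
Context {R : realType} {n : nat}.

(* [f] is of class C^k on [U]; only meaningful for [U] open. As the space is
   finite-dimensional, ['d f] is of class C^k if and only if all the
   directional derivatives ['D_v f] are. *)
Fixpoint Ck (W : normedModType R) (k : nat) (U : set 'rV[R]_n)
    (f : 'rV[R]_n -> W) : Prop :=
  match k with
  | 0 => forall x, U x -> {for x, continuous f}
  | k'.+1 => (forall x, U x -> differentiable f x) /\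
             (forall v, Ck k' U ('D_v f))
  end.

Definition smooth_on (W : normedModType R) (U : set 'rV[R]_n)
    (f : 'rV[R]_n -> W) : Prop := forall k, Ck k U f.

Lemma near_differentiable (W : normedModType R) (f g : 'rV[R]_n -> W) x :
  (\near x, f x = g x) -> differentiable f x -> differentiable g x.
Proof.
move=> fg df; have [dfc dfo] := (diff_locallyP x f).1 df.
have fgx : f x = g x by exact: nbhs_singleton fg.
have go : g \o shift x = cst (g x) + 'd f x +o_ 0 id.
  apply/eqaddoP => e e0; move/eqaddoP: dfo => /(_ e e0) dfo.
  have fg0 : \forall h \near 0, f (h + x) = g (h + x).
    by move: fg; rewrite (near_shift 0) /=; apply: filterS => h; rewrite /= subr0.
  apply: filterS2 dfo fg0 => h dfh fgh.
  by move: dfh; rewrite !fctE /= -fgx -fgh.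
have Edg := diff_unique dfc go.
by apply/diff_locallyP; rewrite Edg.
Qed.

Lemma Ck_eq (W : normedModType R) k (U : set 'rV[R]_n) (f g : 'rV[R]_n -> W) :
  open U -> (forall x, U x -> f x = g x) -> Ck k U f -> Ck k U g.
Proof.
move=> oU; elim: k f g => [|k IH] f g fg /=.
  move=> fc x Ux; rewrite /prop_for /continuous_at -(fg _ Ux).
  have nfg : {near x, f =1 g}.
    by apply: filterS (open_nbhs_nbhs (conj oU Ux)) => y /fg.
  exact: cvg_trans (near_eq_cvg nfg) (fc x Ux).
have nfg x : U x -> \near x, f x = g x.
  by move=> Ux; apply: filterS (open_nbhs_nbhs (conj oU Ux)) => y /fg.
move=> [df Df]; split=> [x Ux|v].
  exact: near_differentiable (nfg x Ux) (df x Ux).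
by apply: IH (Df v) => x Ux; exact/near_eq_derive/nfg.
Qed.

Lemma CkW (W : normedModType R) k (U : set 'rV[R]_n) (f : 'rV[R]_n -> W) :
  Ck k.+1 U f -> Ck k U f.
Proof.
elim: k f => [|k IH] f [df Df].
  by move=> x Ux; apply: differentiable_continuous; exact: df.
by split=> // v; exact: IH.
Qed.

Lemma CkD (W : normedModType R) k (U : set 'rV[R]_n) (f g : 'rV[R]_n -> W) :
  open U -> Ck k U f -> Ck k U g -> Ck k U (fun x => f x + g x).
Proof.
move=> oU; elim: k f g => [|k IH] f g /=.
  by move=> cf cg x Ux; apply: continuousD; [exact: cf|exact: cg].
move=> [df Df] [dg Dg]; split=> [x Ux|v].
  by apply: (@differentiableD _ _ _ f g); [exact: df|exact: dg].
apply: Ck_eq (IH _ _ (Df v) (Dg v)) => // x Ux.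
by rewrite -(@deriveD _ _ _ f g) //; apply: diff_derivable; [exact: df|exact: dg].
Qed.

Lemma CkM k (U : set 'rV[R]_n) (f g : 'rV[R]_n -> R) :
  open U -> Ck k U f -> Ck k U g -> Ck k U (fun x => f x * g x).
Proof.
move=> oU; elim: k f g => [|k IH] f g.
  by move=> cf cg x Ux; apply: continuousM; [exact: cf|exact: cg].
move=> Cf Cg; have [df Df] := Cf; have [dg Dg] := Cg; split=> [x Ux|v].
  by apply: (@differentiableM _ _ f g); [exact: df|exact: dg].
have H := CkD oU (IH _ _ (CkW Cf) (Dg v)) (IH _ _ (CkW Cg) (Df v)).
apply: Ck_eq H => // x Ux.
by rewrite -(@deriveM _ _ f g) //; apply: diff_derivable; [exact: df|exact: dg].
Qed.

Lemma Ck_cst (W : normedModType R) k (U : set 'rV[R]_n) (a : W) :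
  Ck k U (fun=> a).
Proof.
elim: k a => [|k IH] a /=; first by move=> x _; exact: cst_continuous.
split=> [x _|v]; first exact: differentiable_cst.
by rewrite (_ : 'D_v _ = fun=> 0) //; apply/funext => x; exact: derive_cst.
Qed.

Lemma smooth_on_eq (W : normedModType R) (U : set 'rV[R]_n)
    (f g : 'rV[R]_n -> W) :
  open U -> (forall x, U x -> f x = g x) -> smooth_on U f -> smooth_on U g.
Proof. by move=> oU fg sf k; exact: Ck_eq (sf k). Qed.

Lemma smooth_onD (W : normedModType R) (U : set 'rV[R]_n)
    (f g : 'rV[R]_n -> W) : open U ->
  smooth_on U f -> smooth_on U g -> smooth_on U (fun x => f x + g x).
Proof. by move=> oU sf sg k; exact: CkD. Qed.

Lemma smooth_onM (U : set 'rV[R]_n) (f g : 'rV[R]_n -> R) : open U ->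
  smooth_on U f -> smooth_on U g -> smooth_on U (fun x => f x * g x).
Proof. by move=> oU sf sg k; exact: CkM. Qed.

Lemma smooth_on_sum (I : Type) (r : seq I) (U : set 'rV[R]_n)
    (F : I -> 'rV[R]_n -> R) : open U ->
  (forall i, smooth_on U (F i)) -> smooth_on U (fun x => \sum_(i <- r) F i x).
Proof.
move=> oU sF; elim: r => [|i r IH].
  by apply: (@smooth_on_eq _ _ (fun=> 0)) => // [x _|k]; [rewrite big_nil|exact: Ck_cst].
apply: smooth_on_eq (smooth_onD oU (sF i) IH) => // x _.
by rewrite big_cons.
Qed.

Lemma smooth_on_derive (W : normedModType R) (U : set 'rV[R]_n)
    (f : 'rV[R]_n -> W) v : smooth_on U f -> smooth_on U ('D_v f).
Proof. by move=> sf k; have [_] := sf k.+1; exact. Qed.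

Lemma smooth_on_differentiable (W : normedModType R) (U : set 'rV[R]_n)
    (f : 'rV[R]_n -> W) x : smooth_on U f -> U x -> differentiable f x.
Proof. by move=> sf; have [+ _] := sf 1%N; exact. Qed.

Definition smooth_mx_on (m q : nat) (U : set 'rV[R]_n)
    (A : 'rV[R]_n -> 'M[R]_(m, q)) : Prop :=
  forall i j, smooth_on U (fun x => A x i j).

Lemma smooth_mx_on_eq m q (U : set 'rV[R]_n) (A B : 'rV[R]_n -> 'M[R]_(m, q)) :
  open U -> (forall x, U x -> A x = B x) -> smooth_mx_on U A -> smooth_mx_on U B.
Proof.
by move=> oU AB sA i j; apply: smooth_on_eq (sA i j) => // x /AB ->.
Qed.

Lemma smooth_mx_onD m q (U : set 'rV[R]_n) (A B : 'rV[R]_n -> 'M[R]_(m, q)) :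
  open U -> smooth_mx_on U A -> smooth_mx_on U B ->
  smooth_mx_on U (fun x => A x + B x).
Proof.
move=> oU sA sB i j; apply: smooth_on_eq (smooth_onD oU (sA i j) (sB i j)) => //.
by move=> x _; rewrite mxE.
Qed.

Lemma smooth_mx_onM m q s (U : set 'rV[R]_n)
    (A : 'rV[R]_n -> 'M[R]_(m, q)) (B : 'rV[R]_n -> 'M[R]_(q, s)) :
  open U -> smooth_mx_on U A -> smooth_mx_on U B ->
  smooth_mx_on U (fun x => A x *m B x).
Proof.
move=> oU sA sB i j.
have H : smooth_on U (fun x => \sum_k A x i k * B x k j).
  by apply: smooth_on_sum => // k; exact: smooth_onM.
by apply: smooth_on_eq H => // x _; rewrite mxE.
Qed.

Lemma smooth_mx_on_tr m q (U : set 'rV[R]_n) (A : 'rV[R]_n -> 'M[R]_(m, q)) :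
  open U -> smooth_mx_on U A -> smooth_mx_on U (fun x => (A x)^T).
Proof.
by move=> oU sA i j; apply: smooth_on_eq (sA j i) => // x _; rewrite mxE.
Qed.

Lemma smooth_mx_onZ m q (U : set 'rV[R]_n) (f : 'rV[R]_n -> R)
    (A : 'rV[R]_n -> 'M[R]_(m, q)) :
  open U -> smooth_on U f -> smooth_mx_on U A ->
  smooth_mx_on U (fun x => f x *: A x).
Proof.
move=> oU sf sA i j; apply: smooth_on_eq (smooth_onM oU sf (sA i j)) => //.
by move=> x _; rewrite mxE.
Qed.

Definition gradient (F : 'rV[R]_n -> R) (x : 'rV[R]_n) : 'cV[R]_n :=
  \col_k 'D_(delta_mx 0 k) F x.

Lemma smooth_gradient (U : set 'rV[R]_n) (F : 'rV[R]_n -> R) :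
  open U -> smooth_on U F -> smooth_mx_on U (gradient F).
Proof.
move=> oU sF i j; apply: smooth_on_eq (smooth_on_derive (delta_mx 0 i) sF) => //.
by move=> x _; rewrite mxE.
Qed.

Lemma derive_gradient (F : 'rV[R]_n -> R) x v :
  differentiable F x -> 'D_v F x = (v *m gradient F x) 0 0.
Proof.
move=> dF; rewrite deriveE // {1}(row_sum_delta v) linear_sum mxE /=.
by apply: eq_bigr => k _; rewrite linearZ mxE deriveE.
Qed.

Lemma gradient_comp (F : 'rV[R]_n -> R) (G : 'rV[R]_n -> 'rV[R]_n) x :
  differentiable G x -> differentiable F (G x) ->
  gradient (F \o G) x = 'J G x *m gradient F (G x).
Proof.
move=> dG dF; apply/colP => k; rewrite mxE deriveE; last first.
  exact: differentiable_comp.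
rewrite diff_comp //= -deriveE // derive_gradient // -deriveE //.
by rewrite deriveEjacobian // -rowE -row_mul mxE.
Qed.

End SmoothOn.

Record chart (R : realType) (n : nat) (M : topologicalType) := Chart {
  dom : set M ;
  coord : M -> 'rV[R]_n ;
  param : 'rV[R]_n -> M ;
  open_dom : open dom ;
  open_cod : open (coord @` dom) ;
  coordK : forall p, dom p -> param (coord p) = p ;
  coord_continuous : forall p, dom p -> {for p, continuous coord} ;
  param_continuous : forall x, (coord @` dom) x -> {for x, continuous param} }.

Arguments open_dom {R n M} c : rename.
Arguments open_cod {R n M} c : rename.

Definition cod (R : realType) (n : nat) (M : topologicalType)
  (c : chart R n M) : set 'rV[R]_n := coord c @` dom c.

(* A smooth manifold of dimension [n]; the atlas need not be maximal. *)
Record manifold (R : realType) (n : nat) := Manifold {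
  carrier :> topologicalType ;
  atlas : set (chart R n carrier) ;
  manifold_hausdorff : hausdorff_space carrier ;
  manifold_second_countable : @second_countable carrier ;
  atlas_cover : forall p, exists c, atlas c /\ dom c p ;
  atlas_compatible : forall c d, atlas c -> atlas d ->
    smooth_on (coord c @` (dom c `&` dom d)) (coord d \o param c) }.

Section Fields.
Context {R : realType} {n : nat} {M : manifold R n}.
Implicit Types (p : M) (c d : chart R n M).

(* A chosen chart around [p]. The tangent space at [p] is ['rV[R]_n], identified
   with T_pM by means of this chart; the cotangent space is its dual ['cV[R]_n],
   the pairing of [a : 'cV[R]_n] with [v : 'rV[R]_n] being [(v *m a) 0 0]. *)
Definition chart_at p : chart R n M := projT1 (cid (atlas_cover p)).

Lemma chart_at_atlas p : atlas (chart_at p).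
Proof. by rewrite /chart_at; case: cid => c []. Qed.

Lemma chart_at_dom p : dom (chart_at p) p.
Proof. by rewrite /chart_at; case: cid => c []. Qed.

(* Jacobian matrix at [p] of the change of coordinates from [c] to [d]: a tangent
   vector with components [v] in [c] has components [v *m jac c d p] in [d]. *)
Definition jac c d p : 'M[R]_n := 'J (coord d \o param c) (coord c p).

Definition smooth (f : M -> R) : Prop :=
  forall c, atlas c -> smooth_on (cod c) (f \o param c).

(* df at [p]. *)
Definition differential (f : M -> R) p : 'cV[R]_n :=
  gradient (f \o param (chart_at p)) (coord (chart_at p) p).

(* Vector fields, contravariant and covariant 2-tensor fields are smooth when
   their components in each chart of the atlas are. *)
Definition smooth_vector (X : M -> 'rV[R]_n) : Prop :=
  forall c, atlas c -> smooth_mx_on (cod c)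
    (fun x => let p := param c x in X p *m jac (chart_at p) c p).

Definition smooth_contravariant2 (T : M -> 'M[R]_n) : Prop :=
  forall c, atlas c -> smooth_mx_on (cod c)
    (fun x => let p := param c x in
      (jac (chart_at p) c p)^T *m T p *m jac (chart_at p) c p).

Definition smooth_covariant2 (T : M -> 'M[R]_n) : Prop :=
  forall c, atlas c -> smooth_mx_on (cod c)
    (fun x => let p := param c x in
      jac c (chart_at p) p *m T p *m (jac c (chart_at p) p)^T).

Lemma paramK c x : cod c x -> coord c (param c x) = x.
Proof. by move=> [p cp <-]; rewrite coordK. Qed.

Lemma param_dom c x : cod c x -> dom c (param c x).
Proof. by move=> [p cp <-]; rewrite coordK. Qed.

Lemma overlapE c d :
  coord c @` (dom c `&` dom d) = [set x | cod c x /\ dom d (param c x)].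
Proof.
apply/seteqP; split=> [_ [p [cp dp] <-]|x [cx dx]] /=.
  by split; [exists p|rewrite coordK].
by exists (param c x); [split=> //; exact: param_dom|exact: paramK].
Qed.

Lemma open_overlap c d : open (coord c @` (dom c `&` dom d)).
Proof.
rewrite overlapE openE => x [cx dx].
apply: (@filterI _ (nbhs x) _ (cod c) (param c @^-1` dom d)).
  by apply: open_nbhs_nbhs; split; first exact: open_cod.
exact: (param_continuous cx (open_nbhs_nbhs (conj (open_dom d) dx))).
Qed.

Lemma differential_chart (f : M -> R) c p : smooth f -> atlas c -> dom c p ->
  differential f p = jac (chart_at p) c p *m gradient (f \o param c) (coord c p).
Proof.
move=> sf ac cp; rewrite /differential /jac.
set b := chart_at p; have bp : dom b p := chart_at_dom p.
have ob : (coord b @` (dom b `&` dom c)) (coord b p) by exists p.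
have dT := smooth_on_differentiable
  (atlas_compatible (chart_at_atlas p) ac) ob.
have Ep : (coord c \o param b) (coord b p) = coord c p by rewrite /= coordK.
have dF : differentiable (f \o param c) ((coord c \o param b) (coord b p)).
  by rewrite Ep; apply: smooth_on_differentiable (sf c ac) _; exists p.
rewrite -Ep -gradient_comp //; apply/colP => k; rewrite !mxE.
apply: near_eq_derive.
have nb : nbhs (coord b p) (coord b @` (dom b `&` dom c)).
  by apply: open_nbhs_nbhs; split; first exact: open_overlap.
apply: filterS nb => _ [q [bq cq] <-].
by rewrite /= coordK // coordK.
Qed.

Record smooth_function := SmoothFunction {
  sf_fun :> M -> R ;
  sf_smooth : smooth sf_fun }.

Record vector_field := VectorField {
  vf_fun :> M -> 'rV[R]_n ;
  vf_smooth : smooth_vector vf_fun }.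

(* Sections of Sym^2 TM; [theta p] is the matrix of a symmetric bilinear form on
   the cotangent space at [p]. *)
Record symmetric_bivector := SymmetricBivector {
  sb_fun :> M -> 'M[R]_n ;
  sb_sym : forall p, (sb_fun p)^T = sb_fun p ;
  sb_smooth : smooth_contravariant2 sb_fun }.

Implicit Types (f h : smooth_function) (X Y Z : vector_field).
Implicit Types theta : symmetric_bivector.

Lemma vf_add_smooth X Y : smooth_vector (fun p => X p + Y p).
Proof.
move=> c ac; have oc := open_cod c.
have H := smooth_mx_onD oc (vf_smooth X ac) (vf_smooth Y ac).
apply: (smooth_mx_on_eq oc _ H) => x _ /=.
by rewrite mulmxDl.
Qed.

Definition vf_add X Y : vector_field := VectorField (vf_add_smooth X Y).

Lemma vf_scale_smooth f X : smooth_vector (fun p => f p *: X p).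
Proof.
move=> c ac; have oc := open_cod c.
have H := smooth_mx_onZ oc (sf_smooth f ac) (vf_smooth X ac).
apply: (smooth_mx_on_eq oc _ H) => x _ /=.
by rewrite scalemxAl.
Qed.

Definition vf_scale f X : vector_field := VectorField (vf_scale_smooth f X).

(* The function X(f) = df(X), for an arbitrary [f]. *)
Definition lie_derivative (X : M -> 'rV[R]_n) (f : M -> R) : M -> R :=
  fun p => (X p *m differential f p) 0 0.

Lemma vf_apply_smooth X f : smooth (lie_derivative X f).
Proof.
move=> c ac; have oc := open_cod c.
have sg : smooth_mx_on (cod c) (gradient (f \o param c)).
  exact: smooth_gradient (sf_smooth f ac).
have H := smooth_mx_onM oc (vf_smooth X ac) sg 0 0.
apply: (smooth_on_eq oc _ H) => x cx /=.
rewrite /lie_derivative (differential_chart (sf_smooth f) ac (param_dom cx)).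
by rewrite paramK // mulmxA.
Qed.

Definition vf_apply X f : smooth_function := SmoothFunction (vf_apply_smooth X f).

(* theta(a, b), and theta viewed as a map from T*_pM to T_pM, so that
   b(sharp theta p a) = bivector_pairing theta p a b. *)
Definition bivector_pairing theta p (a b : 'cV[R]_n) : R :=
  (a^T *m theta p *m b) 0 0.

Definition sharp theta p (a : 'cV[R]_n) : 'rV[R]_n := a^T *m theta p.

Definition nondegenerate_bivector theta : Prop := forall p, bijective (sharp theta p).

Lemma bracket_smooth theta f h :
  smooth (fun p => bivector_pairing theta p (differential f p) (differential h p)).
Proof.
move=> c ac; have oc := open_cod c.
have sg k : smooth_mx_on (cod c) (gradient (sf_fun k \o param c)).
  exact: smooth_gradient (sf_smooth k ac).
have H := smooth_mx_onM oc (smooth_mx_onM oc (smooth_mx_on_tr oc (sg f))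
  (sb_smooth theta ac)) (sg h).
apply: (smooth_on_eq oc _ (H 0 0)) => x cx /=.
rewrite /bivector_pairing.
rewrite (differential_chart (sf_smooth f) ac (param_dom cx)).
rewrite (differential_chart (sf_smooth h) ac (param_dom cx)).
by rewrite paramK // trmx_mul !mulmxA.
Qed.

Definition bracket theta f h : smooth_function :=
  SmoothFunction (bracket_smooth theta f h).

Lemma hamiltonian_smooth theta f :
  smooth_vector (fun p => sharp theta p (differential f p)).
Proof.
move=> c ac; have oc := open_cod c.
have sg : smooth_mx_on (cod c) (gradient (f \o param c)).
  exact: smooth_gradient (sf_smooth f ac).
have H := smooth_mx_onM oc (smooth_mx_on_tr oc sg) (sb_smooth theta ac).
apply: (smooth_mx_on_eq oc _ H) => x cx /=.
rewrite /sharp (differential_chart (sf_smooth f) ac (param_dom cx)).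
by rewrite paramK // trmx_mul !mulmxA.
Qed.

Definition hamiltonian theta f : vector_field :=
  VectorField (hamiltonian_smooth theta f).

Record connection := Connection {
  nabla :> vector_field -> vector_field -> vector_field ;
  nablaDl : forall X Y Z, nabla (vf_add X Y) Z = vf_add (nabla X Z) (nabla Y Z) ;
  nablaZl : forall f X Y, nabla (vf_scale f X) Y = vf_scale f (nabla X Y) ;
  nablaDr : forall X Y Z, nabla X (vf_add Y Z) = vf_add (nabla X Y) (nabla X Z) ;
  nabla_leibniz : forall X f Y, nabla X (vf_scale f Y) =
    vf_add (vf_scale (vf_apply X f) Y) (vf_scale f (nabla X Y)) }.

(* [Z] is the Lie bracket [X, Y]. *)
Definition is_lie_bracket X Y (Z : M -> 'rV[R]_n) : Prop :=
  forall f p, lie_derivative Z f p =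
    vf_apply X (vf_apply Y f) p - vf_apply Y (vf_apply X f) p.

Definition torsion_free (D : connection) : Prop :=
  forall X Y, is_lie_bracket X Y (fun p => D X Y p - D Y X p).

Definition symmetric_bracket (D : connection) X Y : vector_field :=
  vf_add (D X Y) (D Y X).

Definition strong_symmetric_poisson theta (D : connection) : Prop :=
  torsion_free D /\
  forall f h, hamiltonian theta (bracket theta f h) =
    symmetric_bracket D (hamiltonian theta f) (hamiltonian theta h).

(* Fields of bilinear forms on the tangent spaces: [g p] is the matrix of the
   form (v, w) |-> form_pairing g p v w, viewed as the map v |-> flat g p v from
   T_pM to T*_pM. *)
Definition form_pairing (g : M -> 'M[R]_n) p (v w : 'rV[R]_n) : R :=
  (v *m g p *m w^T) 0 0.

Definition flat (g : M -> 'M[R]_n) p (v : 'rV[R]_n) : 'cV[R]_n := (v *m g p)^T.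

Definition pseudo_riemannian_metric (g : M -> 'M[R]_n) : Prop :=
  [/\ smooth_covariant2 g, forall p, (g p)^T = g p
    & forall p, bijective (flat g p)].

(* For [theta] non-degenerate, [flat (inverse_form theta) p] is the inverse of
   [sharp theta p]; see [sharpK] and [flatK]. *)
Definition inverse_form theta : M -> 'M[R]_n := fun p => invmx (theta p).

Lemma nondegenerate_unitmx theta p : nondegenerate_bivector theta -> theta p \in unitmx.
Proof.
move=> /(_ p) /bij_inj inj; rewrite -row_free_unit -kermx_eq0.
apply/eqP/row_matrixP => i; rewrite row0.
have H : sharp theta p (row i (kermx (theta p)))^T = sharp theta p 0.
  by rewrite /sharp trmxK trmx0 mul0mx -row_mul mulmx_ker row0.
by rewrite -[LHS]trmxK (inj _ _ H) trmx0.
Qed.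

Lemma sharpK theta p : nondegenerate_bivector theta ->
  cancel (sharp theta p) (flat (inverse_form theta) p).
Proof.
move=> /(nondegenerate_unitmx p) u a.
by rewrite /flat /sharp /inverse_form mulmxK // trmxK.
Qed.

Lemma flatK theta p : nondegenerate_bivector theta ->
  cancel (flat (inverse_form theta) p) (sharp theta p).
Proof.
move=> /(nondegenerate_unitmx p) u v.
by rewrite /flat /sharp /inverse_form trmxK mulmxKV.
Qed.

Definition metric_compatible (g : M -> 'M[R]_n) (D : connection) : Prop :=
  forall X Y Z p,
    lie_derivative X (fun q => form_pairing g q (Y q) (Z q)) p =
    form_pairing g p (D X Y p) (Z p) + form_pairing g p (Y p) (D X Z p).

Definition levi_civita (g : M -> 'M[R]_n) (D : connection) : Prop :=
  torsion_free D /\ metric_compatible g D.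

End Fields.

Arguments smooth_function {R n} M.
Arguments vector_field {R n} M.
Arguments symmetric_bivector {R n} M.
Arguments connection {R n} M.

(* Main.v *)
Require Import Defs.
From mathcomp Require Import all_boot all_order all_algebra.
From mathcomp Require Import all_classical all_reals all_analysis.
From mathcomp Require Import ring lra.
Import Defs.
Set Implicit Arguments.
Unset Strict Implicit.
Unset Printing Implicit Defensive.
Import Order.TTheory GRing.Theory Num.Theory.
Import numFieldNormedType.Exports.
Local Open Scope classical_set_scope.
Local Open Scope ring_scope.

(** Write A(f,h;k) = g(nabla_{X_f} X_h, X_k) with g = theta^-1, so that
    g(X_f, X_h) = {f,h}. Torsion-freeness reads
    A(f,h;k) - A(h,f;k) = X_f{h,k} - X_h{f,k}; granted this, the strong Poisson
    identity X_k{f,h} = A(f,h;k) + A(h,f;k) and the metric identity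
    X_f{h,k} = A(f,h;k) + A(f,k;h) are both equivalent to the Koszul formula for
    A. Hamiltonian vector fields take every value at a given point and nabla g
    is tensorial, so the metric identity on them already gives nabla g = 0. The
    bijection then follows from the fundamental theorem of Riemannian geometry,
    where nabla_X Y is read off from the Koszul expression, a tensor in Z. All
    localisations go through cutoff functions built from exp(-1/t), and the Lie
    bracket rests on the symmetry of second derivatives. *)

(** * Calculus of smooth maps *)

Section SmoothCalculus.
Context {R : realType} {n : nat}.
Implicit Types (U V : set 'rV[R]_n) (W : normedModType R).

(** Functions, vector fields and connections are global objects here, so there are no local frames
    or Christoffel symbols to compute with: a local object must be cut off and extended by zero
    before a connection can act on it. A second obstacle is that the tangent space at [p] is
    ['rV[R]_n] read in the chart [chart_at p], which varies with [p] without any continuity. The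
    values of a field chosen point by point therefore show nothing of its smoothness; this is
    recovered from the functions [lie_derivative V f] by [smooth_vector_derivation]. For the Lie
    bracket such a function is X(Yf) - Y(Xf); for the Levi-Civita connection it is half the Koszul
    expression tested on the gradient of [f]. *)

Lemma Ck_local W k U (f : 'rV[R]_n -> W) :
  (forall x, U x -> exists2 V, V x & Ck k V f) -> Ck k U f.
Proof.
elim: k f => [|k IH] f Uf /=.
  by move=> x /Uf[V Vx]; apply.
split=> [x /Uf[V Vx [df _]]|v]; first exact: df.
by apply: IH => x /Uf[V Vx [_ Df]]; exists V; last exact: Df.
Qed.

Lemma smooth_on_local W U (f : 'rV[R]_n -> W) :
  (forall x, U x -> exists2 V, V x & smooth_on V f) -> smooth_on U f.
Proof.
by move=> Uf k; apply: Ck_local => x /Uf[V Vx sf]; exists V; last exact: sf.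
Qed.

Lemma smooth_on_sub W U V (f : 'rV[R]_n -> W) :
  U `<=` V -> smooth_on V f -> smooth_on U f.
Proof. by move=> UV sf; apply: smooth_on_local => x /UV; exists V. Qed.

Lemma smooth_on_cst W U (a : W) : smooth_on U (fun=> a).
Proof. by move=> k; exact: Ck_cst. Qed.

Lemma derivable_entry m q (G : 'rV[R]_n -> 'M[R]_(m, q)) x v i j :
  derivable G x v -> 'D_v (fun y => G y i j) x = 'D_v G x i j.
Proof. by move=> dG; rewrite derive_mx // mxE. Qed.

Lemma Ck_entry k m q U (G : 'rV[R]_n -> 'M[R]_(m, q)) i j :
  open U -> Ck k U G -> Ck k U (fun x => G x i j).
Proof.
move=> oU; elim: k G => [|k IH] G /=.
  move=> cG x Ux; apply: (@continuous_comp _ _ _ G (fun N => N i j)).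
    exact: cG.
  exact: matrix_normedtype.coord_continuous.
move=> [dG DG]; split=> [x Ux|v].
  apply: (@differentiable_comp _ _ _ _ G (fun N => N i j)); first exact: dG.
  exact: differentiable_coord.
apply: Ck_eq (IH _ (DG v)) => // x Ux.
by rewrite derivable_entry //; exact/diff_derivable/dG.
Qed.

Lemma smooth_on_entry m q U (G : 'rV[R]_n -> 'M[R]_(m, q)) :
  open U -> smooth_on U G -> smooth_mx_on U G.
Proof. by move=> oU sG i j k; exact: Ck_entry. Qed.

Lemma smooth_on_id U : smooth_on U (@id 'rV[R]_n).
Proof.
case=> [|k]; first by move=> x _; exact: cvg_id.
split=> [x _|v]; first by apply: ex_diff.
rewrite (_ : 'D_v id = fun=> v); first exact: Ck_cst.
by apply/funext => x; rewrite derive_id.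
Qed.

Lemma smooth_on_coord U j : open U -> smooth_on U (fun x : 'rV[R]_n => x 0 j).
Proof. by move=> oU; apply: (smooth_on_entry oU (@smooth_on_id U)). Qed.

Lemma derive_comp m (F : 'rV[R]_m -> R) (G : 'rV[R]_n -> 'rV[R]_m) x v :
  differentiable G x -> differentiable F (G x) ->
  'D_v (F \o G) x = \sum_j 'D_v G x 0 j * 'D_(delta_mx 0 j) F (G x).
Proof.
move=> dG dF; rewrite deriveE; last exact: differentiable_comp.
rewrite diff_comp //= -deriveE // -deriveE // derive_gradient // mxE.
by apply: eq_bigr => j _; rewrite mxE.
Qed.

Lemma CkB W k U (f g : 'rV[R]_n -> W) :
  open U -> Ck k U f -> Ck k U g -> Ck k U (fun x => f x - g x).
Proof.
move=> oU; elim: k f g => [|k IH] f g /=.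
  by move=> cf cg x Ux; apply: continuousB; [exact: cf|exact: cg].
move=> [df Df] [dg Dg]; split=> [x Ux|v].
  by apply: (@differentiableB _ _ _ f g); [exact: df|exact: dg].
apply: Ck_eq (IH _ _ (Df v) (Dg v)) => // x Ux.
by rewrite -(@deriveB _ _ _ f g) //; apply: diff_derivable;
  [exact: df|exact: dg].
Qed.

Lemma smooth_onB W U (f g : 'rV[R]_n -> W) :
  open U -> smooth_on U f -> smooth_on U g -> smooth_on U (fun x => f x - g x).
Proof. by move=> oU sf sg k; exact: CkB. Qed.

Lemma Ck_sum (I : Type) (r : seq I) k U (F : I -> 'rV[R]_n -> R) : open U ->
  (forall i, Ck k U (F i)) -> Ck k U (fun x => \sum_(i <- r) F i x).
Proof.
move=> oU sF; elim: r => [|i r IH].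
  apply: (@Ck_eq _ _ _ _ _ (fun=> 0)) => //; last exact: Ck_cst.
  by move=> x _; rewrite big_nil.
apply: Ck_eq (CkD oU (sF i) IH) => // x _.
by rewrite big_cons.
Qed.

Lemma smooth_on_prod (I : Type) (r : seq I) U (F : I -> 'rV[R]_n -> R) :
  open U -> (forall i, smooth_on U (F i)) ->
  smooth_on U (fun x => \prod_(i <- r) F i x).
Proof.
move=> oU sF; elim: r => [|i r IH].
  apply: (@smooth_on_eq _ _ _ _ (fun=> 1 : R)) => //; last exact: smooth_on_cst.
  by move=> x _; rewrite big_nil.
by apply: smooth_on_eq (smooth_onM oU (sF i) IH) => // x _; rewrite big_cons.
Qed.

(** The derivative of the inverse is minus its square times ['D_v f], so order [k] for the inverse
    yields order [k.+1]. *)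
Lemma CkV k U (f : 'rV[R]_n -> R) :
  open U -> (forall x, U x -> f x != 0) -> Ck k U f ->
  Ck k U (fun x => (f x)^-1).
Proof.
move=> oU f0; elim: k => [|k IH].
  by move=> cf x Ux; apply: continuousV; [exact: f0|exact: cf].
move=> Cf; have [df Df] := Cf; split=> [x Ux|v].
  by apply: differentiableV; [exact: df|exact: f0].
have Vf := IH (CkW Cf).
have H := CkM oU (CkM oU Vf Vf) (CkM oU (Ck_cst k U (-1 : R)) (Df v)).
apply: Ck_eq H => // x Ux; rewrite deriveV; last 2 first.
- exact: f0.
- exact/diff_derivable/df.
by rewrite mulN1r mulrN scaleNr /GRing.scale /= -invrM ?unitfE ?f0 // expr2.
Qed.

Lemma smooth_onV U (f : 'rV[R]_n -> R) : open U ->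
  (forall x, U x -> f x != 0) -> smooth_on U f -> smooth_on U (fun x => (f x)^-1).
Proof. by move=> oU f0 sf k; exact: CkV. Qed.

Lemma smooth_mx_on_det m U (A : 'rV[R]_n -> 'M[R]_m) :
  open U -> smooth_mx_on U A -> smooth_on U (fun x => \det (A x)).
Proof.
move=> oU sA; apply: smooth_on_sum => // s.
apply: smooth_onM => //; first exact: smooth_on_cst.
by apply: smooth_on_prod => // i; exact: sA.
Qed.

(** Cramer's rule: cofactors and determinant are polynomials in the entries. *)
Lemma smooth_mx_on_inv m U (A : 'rV[R]_n -> 'M[R]_m) : open U ->
  (forall x, U x -> A x \in unitmx) -> smooth_mx_on U A ->
  smooth_mx_on U (fun x => invmx (A x)).
Proof.
move=> oU uA sA i j.
have sdet : smooth_on U (fun x => (\det (A x))^-1).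
  apply: smooth_onV => //; last exact: smooth_mx_on_det.
  by move=> x /uA; rewrite unitmxE unitfE.
have sadj : smooth_on U (fun x => \adj (A x) i j).
  apply: (@smooth_on_eq _ _ _ _ (fun x => (-1) ^+ (j + i) *
      \det (row' j (col' i (A x))))) => //; first by move=> x _; rewrite mxE.
  apply: smooth_onM => //; first exact: smooth_on_cst.
  apply: smooth_mx_on_det => // a b.
  by apply: smooth_on_eq (sA (lift j a) (lift i b)) => // x _; rewrite !mxE.
apply: (smooth_on_eq oU _ (smooth_onM oU sdet sadj)) => x Ux.
by rewrite /invmx uA // [in RHS]mxE.
Qed.

End SmoothCalculus.

(** The induction keeps [G] and varies [F]: the chain rule composes the partial derivatives of [F]
    with the same [G]. *)
Lemma Ck_comp (R : realType) (n m k : nat) (U : set 'rV[R]_n)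
    (V : set 'rV[R]_m) (F : 'rV[R]_m -> R) (G : 'rV[R]_n -> 'rV[R]_m) :
  open U -> (forall x, U x -> V (G x)) ->
  Ck k V F -> Ck k U G -> Ck k U (F \o G).
Proof.
move=> oU UV; elim: k F => [|k IH] F.
  by move=> cF cG x Ux; apply: continuous_comp; [exact: cG|apply/cF/UV].
move=> CF CG; have [dF DF] := CF; have [dG DG] := CG; split=> [x Ux|v].
  by apply: differentiable_comp; [exact: dG|exact/dF/UV].
have H : Ck k U
    (fun x => \sum_j 'D_v G x 0 j * ('D_(delta_mx 0 j) F \o G) x).
  apply: Ck_sum => // j; apply: CkM => //; first
      exact: (Ck_entry 0 j oU (DG v)).
  by apply: IH; [exact: DF|exact: CkW].
apply: Ck_eq H => // x Ux; rewrite derive_comp //; first exact: dG.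
exact/dF/UV.
Qed.

Lemma smooth_on_comp (R : realType) (n m : nat) (U : set 'rV[R]_n)
    (V : set 'rV[R]_m) (F : 'rV[R]_m -> R) (G : 'rV[R]_n -> 'rV[R]_m) :
  open U -> (forall x, U x -> V (G x)) ->
  smooth_on V F -> smooth_on U G -> smooth_on U (F \o G).
Proof. by move=> oU UV sF sG k; exact: (Ck_comp oU UV (sF k) (sG k)). Qed.

(** * Cutoff functions and symmetry of second derivatives *)

Section FlatFunction.
Context {R : realType}.
Implicit Types (t : R) (k : nat).

(* This family is closed under differentiation up to linear combinations, which
   makes the smoothness of t |-> exp(-1/t) an induction on the order. *)
Definition flat_exp k t : R := if 0 < t then t^-1 ^+ k * expR (- t^-1) else 0.

Lemma flat_exp_ge0 k t : 0 <= flat_exp k t.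
Proof.
rewrite /flat_exp; case: ifP => // t0.
by rewrite mulr_ge0 ?expR_ge0 // exprn_ge0 // invr_ge0 ltW.
Qed.

Lemma flat_exp_mul k t : t * flat_exp k.+1 t = flat_exp k t.
Proof.
rewrite /flat_exp; case: ifPn => [t0|_]; last by rewrite mulr0.
by rewrite exprS !mulrA mulfV ?mul1r // gt_eqF.
Qed.

(** With [u = t^-1] and [N = k.+1], raising [u / N <= expR (u / N)] to the power [N] bounds [expR u]
    below by [(u / N) ^+ N]. This is one power of [u] more than the numerator [u ^+ k], which leaves
    the factor [t]. *)
Lemma flat_exp_le k t : 0 <= t -> flat_exp k t <= k.+1%:R ^+ k.+1 * t.
Proof.
rewrite le_eqVlt => /predU1P[<-|t0]; first by rewrite /flat_exp ltxx mulr0.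
rewrite /flat_exp t0 expRN.
set u := t^-1; have u0 : 0 < u by rewrite invr_gt0.
have N0 : 0 < k.+1%:R :> R by rewrite ltr0n.
have uE : (u / k.+1%:R) ^+ k.+1 <= expR u.
  have uN : u = k.+1%:R * (u / k.+1%:R) by rewrite mulrC divfK ?gt_eqF.
  rewrite [in leRHS]uN expRM_natl; apply: lerXn2r.
  - by rewrite nnegrE divr_ge0 // ltW.
  - by rewrite nnegrE expR_ge0.
  - by apply: le_trans (expR_ge1Dx _); rewrite lerDr.
rewrite ler_pdivrMr ?expR_gt0 //.
apply: le_trans (ler_wpM2l _ uE); last by rewrite mulr_ge0 ?exprn_ge0 // ltW.
have uk : k.+1%:R ^+ k.+1 * t * (u / k.+1%:R) ^+ k.+1 = u ^+ k.
  have Nk0 : k.+1%:R ^+ k.+1 != 0 :> R by rewrite expf_neq0 // gt_eqF.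
  rewrite expr_div_n [u ^+ k.+1]exprS -(invrK t) -/u.
  by field; rewrite Nk0 gt_eqF.
by rewrite uk.
Qed.

Lemma is_derive_flat_exp k t :
  is_derive t 1 (flat_exp k) (flat_exp k.+2 t - k%:R * flat_exp k.+1 t).
Proof.
have [t0|t0|->] := ltrgtP t 0.
- have -> : flat_exp k.+2 t - k%:R * flat_exp k.+1 t = 0.
    by rewrite /flat_exp ltNge (ltW t0) /= mulr0 subrr.
  apply: near_eq_is_derive (is_derive_cst 0 t 1); near=> s.
  have s0 : s < 0 by near: s; exact: lt_nbhsl.
  by rewrite /flat_exp ltNge (ltW s0).
- have tn0 : t != 0 by rewrite gt_eqF.
  have dV : is_derive t 1 (fun s : R => s^-1) (- t ^- 2).
    have := is_deriveV tn0 (is_derive_id t 1).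
    by rewrite /GRing.scale /= mulr1.
  have dE : is_derive t 1 (expR \o (- (fun s : R => s^-1)))
      (expR (- t^-1) * - - t ^- 2).
    by apply: is_derive1_comp; exact: is_deriveN dV.
  have near_t : \near t, (((fun s : R => s^-1) ^+ k) *
      (expR \o (- (fun s : R => s^-1)))) t = flat_exp k t.
    near=> s; have s0 : 0 < s.
      by near: s; exact: lt_nbhsr.
    by rewrite /flat_exp s0 fctE exprfctE.
  apply: near_eq_is_derive near_t _.
  apply: is_derive_eq (is_deriveM (is_deriveX k dV) dE) _.
  rewrite /flat_exp t0 /GRing.scale /= exprfctE /=.
  case: k => [|k] /=; first by rewrite !expr0 !mul0r; field.
  rewrite !exprS; by field.
- have -> : flat_exp k.+2 0 - k%:R * flat_exp k.+1 0 = 0.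
    by rewrite /flat_exp ltxx mulr0 subrr.
  (* At 0 the difference quotient of [flat_exp k] is [flat_exp k.+1], and [k.+2%:R ^+ k.+2] is the
     constant of its linear bound. *)
  have C0 : 0 < k.+2%:R ^+ k.+2 :> R by rewrite exprn_gt0 // ltr0n.
  have cvg0 : h^-1 *: (flat_exp k (h *: 1 + 0) - flat_exp k 0)
      @[h --> 0^'] --> 0.
    apply/cvgrPdist_le => e e0; near=> h.
    rewrite sub0r normrN addr0 [_%:A]mulr1 [X in _ - X]/flat_exp ltxx subr0.
    have h0 : h != 0 by near: h; exact: nbhs_dnbhs_neq.
    rewrite -(flat_exp_mul k) /GRing.scale /= mulKf // ger0_norm ?flat_exp_ge0 //.
    have [hn|hp] := leP h 0; first by rewrite /flat_exp ltNge hn /= ltW.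
    apply: le_trans (flat_exp_le _ (ltW hp)) _.
    rewrite -ler_pdivlMl // mulrC -(ger0_norm (ltW hp)); near: h.
    by apply: dnbhs0_le; rewrite divr_gt0.
  by apply: DeriveDef; [apply/cvg_ex; exists 0|apply: cvg_lim].
Unshelve. all: by end_near. Qed.

End FlatFunction.

Section Bump.
Context {R : realType} {n : nat}.
Implicit Types (U : set 'rV[R]_n) (a x : 'rV[R]_n) (r : R).

Lemma smooth_flat_exp k U (u : 'rV[R]_n -> R) :
  open U -> smooth_on U u -> smooth_on U (flat_exp k \o u).
Proof.
move=> oU su m; elim: m k => [|m IH] k.
  move=> x Ux; apply: continuous_comp; first exact: (su 0%N x Ux).
  apply/differentiable_continuous/derivable1_diffP.
  by have [] := is_derive_flat_exp k (u x).
have dk t : differentiable (@flat_exp R k) t.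
  by apply/derivable1_diffP; have [] := is_derive_flat_exp k t.
have [du Du] := su m.+1; split=> [x Ux|v].
  by apply: differentiable_comp; [exact: du|exact: dk].
have H := CkM oU (Du v)
  (CkB oU (IH k.+2) (CkM oU (Ck_cst m U (k%:R : R)) (IH k.+1))).
apply: (Ck_eq oU _ H) => x Ux /=.
rewrite [RHS]deriveE; last by apply: differentiable_comp; [exact: du|exact: dk].
rewrite diff_comp //=; last exact: du.
rewrite diff1E // derive1E -deriveE //; last exact: du.
by have [_ ->] := is_derive_flat_exp k (u x).
Qed.

(** Positive exactly on the open cube of half-side [r] about [a]; cubes are the balls of the sup
    norm on ['rV[R]_n]. *)
Definition bump a r x : R :=
  \prod_(j < n) (flat_exp 0 (r + (x 0 j - a 0 j)) *
                 flat_exp 0 (r - (x 0 j - a 0 j))).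

Lemma smooth_bump U a r : open U -> smooth_on U (bump a r).
Proof.
move=> oU; apply: smooth_on_prod => // j.
have sx : smooth_on U (fun x => x 0 j - a 0 j).
  by apply: smooth_onB => //; [exact: smooth_on_coord|exact: smooth_on_cst].
apply: smooth_onM => //; apply: smooth_flat_exp => //.
  by apply: smooth_onD => //; exact: smooth_on_cst.
by apply: smooth_onB => //; exact: smooth_on_cst.
Qed.

(** The compact [K] is returned with [b] because extension by zero to the manifold needs a closed
    set off which the function vanishes, and compactness survives the passage through [param]. *)
Lemma bump_exists U a : open U -> U a ->
  exists b : 'rV[R]_n -> R, exists K : set 'rV[R]_n,
    [/\ compact K, K `<=` U, forall x, ~ K x -> b x = 0,
        b a = 1 & forall V, open V -> smooth_on V b].
Proof.
move=> oU Ua; have /nbhs_ballP[e /= e0 eU] := open_nbhs_nbhs (conj oU Ua).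
(* Half the radius puts the closed cube inside the open ball. *)
pose r := e / 2; have r0 : 0 < r by rewrite divr_gt0.
pose K := [set x : 'rV[R]_n | forall j, `[a 0 j - r, a 0 j + r]%classic (x 0 j)].
have ba : bump a r a != 0.
  apply/prodf_neq0 => j _; rewrite subrr addr0 subr0 mulf_neq0 //;
  by rewrite /flat_exp r0 mulf_neq0 ?expf_neq0 ?invr_eq0 ?gt_eqF ?expR_gt0.
exists (fun x => bump a r x * (bump a r a)^-1), K; split.
- apply: (@rV_compact _ n (fun j => `[a 0 j - r, a 0 j + r]%classic)) => j.
  exact: segment_compact.
- move=> x Kx; apply: eU; split=> // i j; rewrite ord1.
  have := Kx j; rewrite /= in_itv /= /ball /= => /andP[h1 h2].
  rewrite ltr_norml; move: h1 h2; rewrite /r => h1 h2.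
  by apply/andP; split; lra.
- move=> x /existsNP[j] /negP; rewrite /= in_itv /= negb_and -!ltNge => xj.
  apply/eqP; rewrite mulf_eq0; apply/orP; left; apply/prodf_eq0; exists j => //.
  rewrite mulf_eq0 /flat_exp; case/orP: xj => xj; apply/orP; [left|right].
    by rewrite ifF //; apply/negbTE; rewrite -leNgt; lra.
  by rewrite ifF //; apply/negbTE; rewrite -leNgt; lra.
- by rewrite mulfV.
- move=> V oV; apply: smooth_onM => //; first exact: smooth_bump.
  exact: smooth_on_cst.
Qed.

End Bump.

(** * Symmetry of second derivatives by second differences *)

Section Schwarz.
Context {R : realType} {n : nat}.
Implicit Types (U : set 'rV[R]_n) (F : 'rV[R]_n -> R) (x y u v : 'rV[R]_n).

Lemma is_derive_line F y u (s : R) : derivable F (s *: u + y) u ->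
  is_derive s 1 (fun t : R => F (t *: u + y)) ('D_u F (s *: u + y)).
Proof.
have E : (fun h : R => h^-1 *: (F ((h *: 1 + s) *: u + y) - F (s *: u + y))) =
         (fun h : R => h^-1 *: (F (h *: u + (s *: u + y)) - F (s *: u + y))).
  by apply/funext => h; rewrite [_%:A]mulr1 scalerDl addrA.
move=> dF; apply: DeriveDef; first by rewrite /derivable E.
by rewrite /derive E.
Qed.

(** The mean value theorem is used twice: on [F (P s h) - F (P s 0)] as a function of [s], then on
    ['D_u F (P s t)] as a function of [t]. *)
Lemma second_difference F x u v (h : R) : 0 < h ->
  let P (s t : R) := s *: u + (t *: v + x) in
  (forall s t, 0 <= s <= h -> 0 <= t <= h ->
     differentiable F (P s t) /\ differentiable ('D_u F) (P s t)) ->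
  exists s, exists t, [/\ 0 <= s <= h, 0 <= t <= h &
    F (P h h) - F (P h 0) - (F (P 0 h) - F (P 0 0)) =
    h ^+ 2 * 'D_v ('D_u F) (P s t)].
Proof.
move=> h0 P dP.
have h00 : 0 <= (0 : R) <= h by rewrite lexx ltW.
have hhh : 0 <= h <= h by rewrite lexx ltW.
have dg s : 0 <= s <= h -> is_derive s 1 (fun s => F (P s h) - F (P s 0))
    ('D_u F (P s h) - 'D_u F (P s 0)).
  move=> sh; have [d1 _] := dP s h sh hhh; have [d2 _] := dP s 0 sh h00.
  by apply: is_deriveB; apply: is_derive_line; exact: diff_derivable.
have [s sh Es] : exists2 c, c \in `]0, h[%R &
    (F (P h h) - F (P h 0)) - (F (P 0 h) - F (P 0 0)) =
    ('D_u F (P c h) - 'D_u F (P c 0)) * (h - 0).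
  apply: (@MVT _ (fun s => F (P s h) - F (P s 0))
    (fun s => 'D_u F (P s h) - 'D_u F (P s 0)) 0 h h0).
    by move=> s; rewrite in_itv /= => /andP[s0 s1]; apply: dg; rewrite !ltW.
  apply: derivable_within_continuous => s; rewrite in_itv /= => sh.
  by have [] := dg s sh.
have {}sh : 0 <= s <= h.
  by move: sh; rewrite in_itv /= => /andP[s0 s1]; rewrite !ltW.
have PE (t : R) : P s t = t *: v + (s *: u + x) by rewrite /P addrCA.
have dk t : 0 <= t <= h -> is_derive t 1 (fun t => 'D_u F (P s t))
    ('D_v ('D_u F) (P s t)).
  move=> th; rewrite (_ : (fun t => _) =
    (fun t : R => 'D_u F (t *: v + (s *: u + x)))); last first.
    by apply/funext => w; rewrite PE.
  rewrite PE; apply: is_derive_line; rewrite -PE; apply: diff_derivable.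
  by have [] := dP s t sh th.
have [t th Et] : exists2 c, c \in `]0, h[%R &
    'D_u F (P s h) - 'D_u F (P s 0) = 'D_v ('D_u F) (P s c) * (h - 0).
  apply: (@MVT _ (fun t => 'D_u F (P s t))
    (fun t => 'D_v ('D_u F) (P s t)) 0 h h0).
    by move=> t; rewrite in_itv /= => /andP[t0 t1]; apply: dk; rewrite !ltW.
  apply: derivable_within_continuous => t; rewrite in_itv /= => th.
  by have [] := dk t th.
exists s, t; split=> //.
  by move: th; rewrite in_itv /= => /andP[t0 t1]; rewrite !ltW.
by rewrite Es Et subr0; ring.
Qed.

Lemma dist_le_halves (e p q r : R) :
  `|p - r| < e / 2 -> `|q - r| < e / 2 -> `|p - q| <= e.
Proof. by rewrite (distrC q) => pr qr; have := ler_distD r p q; lra. Qed.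

(** The second difference with steps [h *: u] and [h *: v] does not change when [u] and [v] are
    exchanged, so both mixed derivatives take a common value at points near [x]; continuity brings
    them within [e] of each other at [x]. *)
Lemma derive_symmetric U F x u v : open U -> Ck 2 U F -> U x ->
  'D_u ('D_v F) x = 'D_v ('D_u F) x.
Proof.
move=> oU [dF DF] Ux.
apply/eqP; rewrite -subr_eq0 -normr_le0; apply/ler_addgt0Pr => e e0.
rewrite add0r.
have cuv : {for x, continuous ('D_u ('D_v F))} by have [_ H] := DF v; exact: H.
have cvu : {for x, continuous ('D_v ('D_u F))} by have [_ H] := DF u; exact: H.
have e20 : 0 < e / 2 by rewrite divr_gt0.
have nU : nbhs x U by exact: open_nbhs_nbhs.
move/cvgrPdist_lt : cuv => /(_ _ e20) nuv.
move/cvgrPdist_lt : cvu => /(_ _ e20) nvu.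
have nn : nbhs x
    [set y | [/\ U y, `|'D_u ('D_v F) x - 'D_u ('D_v F) y| < e / 2 &
    `|'D_v ('D_u F) x - 'D_v ('D_u F) y| < e / 2]].
  refine (filterS3 _ _ nU nuv nvu) => y Uy h1 h2.
  by split; [exact: Uy|exact: h1|exact: h2].
have /nbhs_ballP[d /= d0 dN] := nn.
(* Chosen so that [h * c] is [d / 2]: the whole parallelogram lies in the ball. The summand 1 keeps
   [c] positive when [u] and [v] vanish. *)
pose c := `|u| + `|v| + 1; have c0 : 0 < c by rewrite ltr_wpDl ?addr_ge0.
pose h := d / (2 * c); have h0 : 0 < h by rewrite divr_gt0 // mulr_gt0.
have inball s t : 0 <= s <= h -> 0 <= t <= h ->
    ball x d (s *: u + (t *: v + x)).
  move=> /andP[s0 sh] /andP[t0 th].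
  rewrite -ball_normE /= addrA opprD addrCA subrr addr0 normrN.
  apply: le_lt_trans (ler_normD _ _) _; rewrite !normrZ !ger0_norm //.
  apply: (@le_lt_trans _ _ (h * c)).
    rewrite /c !mulrDr mulr1; apply: ler_wpDr; first exact: ltW.
    by apply: lerD; apply: ler_wpM2r.
  by rewrite /h invfM mulrA -mulrA mulVf ?gt_eqF // mulr1; lra.
have dd w s t : 0 <= s <= h -> 0 <= t <= h ->
    differentiable F (s *: u + (t *: v + x)) /\
    differentiable ('D_w F) (s *: u + (t *: v + x)).
  move=> sh th; have [Up _ _] := dN _ (inball s t sh th).
  by split; [exact: dF|have [H _] := DF w; exact: H].
have [s1 [t1 [sh1 th1 E1]]] :=
  second_difference h0 (fun s t sh th => dd u s t sh th).
have dd' s t : 0 <= s <= h -> 0 <= t <= h ->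
    differentiable F (s *: v + (t *: u + x)) /\
    differentiable ('D_v F) (s *: v + (t *: u + x)).
  by move=> sh th; rewrite addrCA; exact: dd.
have [s2 [t2 [sh2 th2 E2]]] := second_difference h0 dd'.
have [_ _ H1] := dN _ (inball _ _ sh1 th1).
have [_ H2 _] := dN _ (inball _ _ th2 sh2).
have EE : 'D_v ('D_u F) (s1 *: u + (t1 *: v + x)) =
          'D_u ('D_v F) (t2 *: u + (s2 *: v + x)).
  apply: (@mulfI _ (h ^+ 2)); first by rewrite expf_neq0 // gt_eqF.
  apply: etrans (esym E1) _; rewrite (addrCA (t2 *: u) (s2 *: v) x).
  apply: etrans _ E2; rewrite !scale0r !add0r (addrCA (h *: v) (h *: u) x).
  move: (F _) (F _) (F _) (F _) => /= f1 f2 f3 f4.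
  by ring.
move: H1 H2; rewrite /= EE => H1 H2.
exact: dist_le_halves H2 H1.
Qed.

End Schwarz.

(** * Localisation on manifolds *)

Section Gradient.
Context {R : realType} {n : nat}.
Implicit Types (F G : 'rV[R]_n -> R) (x v : 'rV[R]_n).

Lemma gradientD F G x : differentiable F x -> differentiable G x ->
  gradient (fun y => F y + G y) x = gradient F x + gradient G x.
Proof.
move=> dF dG; apply/colP => k; rewrite !mxE.
by rewrite -(@deriveD _ _ _ F G) //; exact: diff_derivable.
Qed.

Lemma gradientM F G x : differentiable F x -> differentiable G x ->
  gradient (fun y => F y * G y) x = F x *: gradient G x + G x *: gradient F x.
Proof.
move=> dF dG; apply/colP => k; rewrite !mxE.
by apply: (@deriveM _ _ F G); exact: diff_derivable.
Qed.

Lemma gradient_cst (a : R) x : gradient (fun=> a) x = 0.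
Proof. by apply/colP => k; rewrite !mxE; exact: derive_cst. Qed.

Lemma gradient_near F G x : (\near x, F x = G x) -> gradient F x = gradient G x.
Proof. by move=> FG; apply/colP => k; rewrite !mxE; exact: near_eq_derive. Qed.

Lemma gradient_coord j x :
  gradient (fun y : 'rV[R]_n => y 0 j) x = delta_mx j 0.
Proof.
apply/colP => k; rewrite !mxE.
rewrite (@derivable_entry _ _ _ _ (@id 'rV[R]_n)); last exact: derivable_id.
by rewrite derive_id mxE eqxx andbT /= eq_sym.
Qed.

Lemma smooth_on_linear U (a : 'cV[R]_n) : open U ->
  smooth_on U (fun x : 'rV[R]_n => (x *m a) 0 0).
Proof.
move=> oU; apply: (@smooth_on_eq _ _ _ _ (fun x => \sum_j x 0 j * a j 0)) => //.
  by move=> x _; rewrite mxE.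
apply: smooth_on_sum => // j; apply: smooth_onM => //.
  exact: smooth_on_coord.
exact: smooth_on_cst.
Qed.

Lemma gradient_linear (a : 'cV[R]_n) x :
  gradient (fun x : 'rV[R]_n => (x *m a) 0 0) x = a.
Proof.
apply/colP => k; rewrite mxE; set v := delta_mx 0 k.
have -> : a k 0 = (v *m a) 0 0 by rewrite /v -rowE mxE.
apply: cvg_lim => //; apply: cvg_near_cst; near=> h => /=.
 have h0 : h != 0 by near: h; exact: nbhs_dnbhs_neq.
have -> : ((h *: v + x) *m a) 0 0 = h * (v *m a) 0 0 + (x *m a) 0 0.
  by rewrite mulmxDl -scalemxAl mxE [X in X + _]mxE.
by rewrite addrK /GRing.scale /= mulKf.
Unshelve. all: by end_near. Qed.

End Gradient.

(** * Transition Jacobians, extension by zero, tensoriality *)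

Section Manifold.
Context {R : realType} {n : nat} {M : manifold R n}.
Implicit Types (p q : M) (c d e : chart R n M).

Lemma nbhs_overlap c d p : dom c p -> dom d p ->
  nbhs (coord c p) (coord c @` (dom c `&` dom d)).
Proof.
move=> cp dp; apply: open_nbhs_nbhs; split; first exact: open_overlap.
by exists p.
Qed.

Lemma nbhs_cod c p : dom c p -> nbhs (coord c p) (cod c).
Proof.
by move=> cp; apply: open_nbhs_nbhs; split; [exact: open_cod|exists p].
Qed.

Lemma differentiable_transition c d p : atlas c -> atlas d ->
  dom c p -> dom d p -> differentiable (coord d \o param c) (coord c p).
Proof.
move=> ac ad cp dp.
by apply: (smooth_on_differentiable (atlas_compatible ac ad)); exists p.
Qed.

Lemma mulmx_jac c d p (v : 'rV[R]_n) : atlas c -> atlas d ->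
  dom c p -> dom d p ->
  v *m jac c d p = 'D_v (coord d \o param c) (coord c p).
Proof.
by move=> *; rewrite deriveEjacobian //; exact: differentiable_transition.
Qed.

(** The chain rule; with row vectors the change of coordinates applied first stands on the left. *)
Lemma jac_comp c d e p : atlas c -> atlas d -> atlas e ->
  dom c p -> dom d p -> dom e p -> jac c d p *m jac d e p = jac c e p.
Proof.
move=> ac ad ae cp dp ep; apply/row_matrixP => i; rewrite !rowE mulmxA.
move: (delta_mx 0 i) => v.
apply: (etrans (congr1 (mulmxr _) (mulmx_jac v ac ad cp dp))) => /=.
apply: etrans (mulmx_jac _ ad ae dp ep)
  (etrans _ (esym (mulmx_jac v ac ae cp ep))).
have E : (coord d \o param c) (coord c p) = coord d p by rewrite /= coordK.
have dcd := differentiable_transition ac ad cp dp.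
have dde : differentiable (coord e \o param d)
    ((coord d \o param c) (coord c p)).
  by rewrite E; exact: differentiable_transition.
transitivity ('D_v ((coord e \o param d) \o (coord d \o param c)) (coord c p)).
  rewrite [RHS]deriveE; last exact: differentiable_comp.
  by rewrite diff_comp //= !coordK // -!deriveE //; rewrite -E.
apply: near_eq_derive; apply: filterS (nbhs_overlap cp dp) => _ [q [cq dq] <-].
by rewrite /= !coordK.
Qed.

Lemma jac_id c p : atlas c -> dom c p -> jac c c p = 1%:M.
Proof.
move=> ac cp; apply/row_matrixP => i; rewrite !rowE.
rewrite (mulmx_jac _ ac ac cp cp) mulmx1.
rewrite -[RHS](@derive_id _ _ (coord c p)); apply: near_eq_derive.
by apply: filterS (nbhs_cod cp) => _ [q cq <-]; rewrite /= coordK.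
Qed.

Lemma smooth_jac c d : atlas c -> atlas d ->
  smooth_mx_on (coord c @` (dom c `&` dom d)) (fun x => jac c d (param c x)).
Proof.
move=> ac ad i j; have oU := @open_overlap _ _ _ c d.
have H := smooth_on_entry oU (smooth_on_derive (delta_mx 0 i)
  (atlas_compatible ac ad)) 0 j.
apply: (smooth_on_eq oU _ H) => _ [p [cp dp] <-].
by rewrite coordK // -(mulmx_jac _ ac ad cp dp) -rowE mxE.
Qed.

Lemma lie_derivative_chart (X : M -> 'rV[R]_n) (f : M -> R) c p :
  smooth f -> atlas c -> dom c p ->
  lie_derivative X f p =
  (X p *m jac (chart_at p) c p *m gradient (f \o param c) (coord c p)) 0 0.
Proof.
by move=> sf ac cp; rewrite /lie_derivative (differential_chart sf ac cp) mulmxA.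
Qed.

Lemma smooth_differentiable (f : M -> R) c p : smooth f -> atlas c -> dom c p ->
  differentiable (f \o param c) (coord c p).
Proof.
by move=> sf ac cp; apply: (smooth_on_differentiable (sf c ac)); exists p.
Qed.

Lemma smooth_cst (a : R) : smooth (fun _ : M => a).
Proof. by move=> c ac; exact: smooth_on_cst. Qed.

Lemma smoothD (f h : M -> R) :
  smooth f -> smooth h -> smooth (fun p => f p + h p).
Proof.
by move=> sf sh c ac; apply: smooth_onD (sf c ac) (sh c ac); exact: open_cod.
Qed.

Lemma smoothM (f h : M -> R) :
  smooth f -> smooth h -> smooth (fun p => f p * h p).
Proof.
by move=> sf sh c ac; apply: smooth_onM (sf c ac) (sh c ac); exact: open_cod.
Qed.

Lemma differentialD (f h : M -> R) p : smooth f -> smooth h ->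
  differential (fun q => f q + h q) p = differential f p + differential h p.
Proof.
by move=> sf sh; apply: gradientD; apply: smooth_differentiable => //;
  solve [exact: chart_at_atlas|exact: chart_at_dom].
Qed.

Lemma differentialM (f h : M -> R) p : smooth f -> smooth h ->
  differential (fun q => f q * h q) p =
  f p *: differential h p + h p *: differential f p.
Proof.
move=> sf sh; have dp := chart_at_dom p; have ap := chart_at_atlas p.
rewrite /differential.
have -> : (fun q => f q * h q) \o param (chart_at p) = fun x =>
  (f \o param (chart_at p)) x * (h \o param (chart_at p)) x by [].
by rewrite gradientM /= ?coordK //; exact: smooth_differentiable.
Qed.

Lemma vector_field_ext (X Y : vector_field M) : (forall p, X p = Y p) -> X = Y.
Proof.
case: X Y => X sX [Y sY] /= /funext XY; rewrite -XY in sY *.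
by congr VectorField; exact: Prop_irrelevance.
Qed.

(** A compact set is closed because [M] is Hausdorff; without this, an extension by zero could fail
    to be continuous. *)
Lemma closed_param_image c (K : set 'rV[R]_n) :
  compact K -> K `<=` cod c -> closed (param c @` K).
Proof.
move=> cK Kc; apply: compact_closed; first exact: manifold_hausdorff.
apply: continuous_compact => //; apply: continuous_in_subspaceT => x.
by rewrite inE => /Kc; exact: param_continuous.
Qed.

(** The dichotomy behind extension by zero, seen in another chart [d]: near a point of the overlap
    the extension is a composition with a transition map, and near any other point it is identically
    zero. *)
Lemma extension_cover c d (K : set 'rV[R]_n) x :
  compact K -> K `<=` cod c -> cod d x ->
  (coord d @` (dom d `&` dom c)) x \/
  exists V, [/\ open V, V x, V `<=` cod d & forall y, V y ->
    forall z, cod c z -> K z -> param c z <> param d y].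
Proof.
move=> cK Kc dx.
have [cx|ncx] := pselect (dom c (param d x)); [left|right].
  by rewrite overlapE.
pose V := [set y | cod d y /\ (~` (param c @` K)) (param d y)].
exists V; split=> //.
- rewrite openE => y [dy Ky].
  apply: (@filterI _ (nbhs y) _ (cod d) (param d @^-1` (~` (param c @` K)))).
    by apply: open_nbhs_nbhs; split; first exact: open_cod.
  apply: (param_continuous dy); apply: open_nbhs_nbhs; split=> //.
  by apply: closed_openC; exact: closed_param_image.
- split=> // -[z Kz zx]; apply: ncx; rewrite -zx; apply: param_dom.
  exact: Kc.
- by move=> y [].
- by move=> y [_ Ky] z cz Kz zy; apply: Ky; exists z.
Qed.

Definition extend c (u : 'rV[R]_n -> R) : M -> R :=
  fun q => if `[< dom c q >] then u (coord c q) else 0.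

(** [u] gives components in [c], and the Jacobian converts them to the chart that defines the
    tangent space at [q]. *)
Definition extend_vector c (u : 'rV[R]_n -> 'rV[R]_n) : M -> 'rV[R]_n :=
  fun q => if `[< dom c q >] then u (coord c q) *m jac c (chart_at q) q else 0.

Lemma extend_dom c u q : dom c q -> extend c u q = u (coord c q).
Proof. by move=> cq; rewrite /extend asboolT. Qed.

Lemma extend_vector_dom c u q : dom c q ->
  extend_vector c u q = u (coord c q) *m jac c (chart_at q) q.
Proof. by move=> cq; rewrite /extend_vector asboolT. Qed.

Lemma smooth_extend c (K : set 'rV[R]_n) (u : 'rV[R]_n -> R) :
  atlas c -> compact K -> K `<=` cod c -> (forall x, ~ K x -> u x = 0) ->
  smooth_on (cod c) u -> smooth (extend c u).
Proof.
move=> ac cK Kc u0 su d ad; apply: smooth_on_local => x dx.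
have [ox|[V [oV Vx Vd VK]]] := extension_cover cK Kc dx; last first.
  exists V => //; apply: (@smooth_on_eq _ _ _ _ (fun=> 0)) => //; last first.
    exact: smooth_on_cst.
  move=> y Vy /=; rewrite /extend; case: asboolP => // cy; rewrite u0 // => Ky.
  by apply: (VK y Vy _ _ Ky); [exists (param d y)|rewrite coordK].
exists (coord d @` (dom d `&` dom c)) => //; have oU := @open_overlap _ _ _ d c.
have UV y : (coord d @` (dom d `&` dom c)) y -> cod c ((coord c \o param d) y).
  by move=> [q [dq cq] <-]; rewrite /= coordK //; exists q.
have H := smooth_on_comp oU UV su (atlas_compatible ad ac).
apply: (smooth_on_eq oU _ H) => _ [q [dq cq] <-].
by rewrite /= coordK // extend_dom.
Qed.

Lemma smooth_extend_vector c (K : set 'rV[R]_n) (u : 'rV[R]_n -> 'rV[R]_n) :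
  atlas c -> compact K -> K `<=` cod c -> (forall x, ~ K x -> u x = 0) ->
  smooth_mx_on (cod c) u -> smooth_vector (extend_vector c u).
Proof.
move=> ac cK Kc u0 su d ad i j; apply: smooth_on_local => x dx.
have [ox|[V [oV Vx Vd VK]]] := extension_cover cK Kc dx; last first.
  exists V => //; apply: (@smooth_on_eq _ _ _ _ (fun=> 0 : R)) => //; last first.
    exact: smooth_on_cst.
  move=> y Vy /=; rewrite /extend_vector.
  case: asboolP => [cy|]; last by rewrite mul0mx mxE.
  rewrite u0 ?mul0mx ?mxE // => Ky.
  by apply: (VK y Vy _ _ Ky); [exists (param d y)|rewrite coordK].
exists (coord d @` (dom d `&` dom c)) => //; have oU := @open_overlap _ _ _ d c.
have UV y : (coord d @` (dom d `&` dom c)) y ->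
    (coord c @` (dom c `&` dom d)) ((coord c \o param d) y).
  by move=> [q [dq cq] <-]; rewrite /= coordK //; exists q.
have UV' y : (coord d @` (dom d `&` dom c)) y -> cod c ((coord c \o param d) y).
  by move=> [q [dq cq] <-]; rewrite /= coordK //; exists q.
have Hu : smooth_mx_on (coord d @` (dom d `&` dom c))
    (fun y => u (coord c (param d y))).
  by move=> a b; exact: smooth_on_comp oU UV' (su a b) (atlas_compatible ad ac).
(* The chosen charts cancel: [jac c (chart_at q) q *m jac (chart_at q) d q] is [jac c d q]. Its
   smoothness is known in the coordinates of [c], hence the detour of [y] through [coord c]. *)
have HJ : smooth_mx_on (coord d @` (dom d `&` dom c))
    (fun y => jac c d (param c (coord c (param d y)))).
  by move=> a b; exact: smooth_on_comp oU UV (smooth_jac ac ad a b)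
    (atlas_compatible ad ac).
apply: (smooth_on_eq oU _ (smooth_mx_onM oU Hu HJ i j)) => _ [q [dq cq] <-].
rewrite /= (coordK dq) (coordK cq) (extend_vector_dom _ cq) -mulmxA.
by rewrite (jac_comp ac (chart_at_atlas q) ad cq (chart_at_dom q) dq).
Qed.

Lemma chart_cutoff c p : dom c p ->
  exists (b : 'rV[R]_n -> R) (K : set 'rV[R]_n),
  [/\ compact K, K `<=` cod c, forall x, ~ K x -> b x = 0, b (coord c p) = 1
    & forall V : set 'rV[R]_n, open V -> smooth_on V b].
Proof. by move=> cp; apply: bump_exists; [exact: open_cod|exists p]. Qed.

Lemma exists_differential p (a : 'cV[R]_n) :
  exists f : smooth_function M, differential f p = a.
Proof.
pose c := chart_at p; have cp : dom c p := chart_at_dom p.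
have ac : atlas c := chart_at_atlas p; have oc : open (cod c) := open_cod c.
have [b [K [cK Kc b0 b1 sb]]] := chart_cutoff cp.
(* The constant makes [l] vanish at [coord c p], so the product rule leaves no term in the gradient
   of [b]. *)
pose l (x : 'rV[R]_n) := (x *m a) 0 0 + - (coord c p *m a) 0 0.
have sl : smooth_on (cod c) l.
  by apply: smooth_onD => //; [exact: smooth_on_linear|exact: smooth_on_cst].
have su : smooth_on (cod c) (fun x => b x * l x).
  by apply: smooth_onM => //; exact: sb.
have u0 x : ~ K x -> b x * l x = 0 by move=> /b0 ->; rewrite mul0r.
exists (SmoothFunction (smooth_extend ac cK Kc u0 su)).
have cxp : cod c (coord c p) by exists p.
rewrite /differential /= -/c (@gradient_near _ _ _ (fun x => b x * l x)).
  rewrite gradientM; last 2 first.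
  - exact: smooth_on_differentiable (sb _ oc) cxp.
  - exact: smooth_on_differentiable sl cxp.
  rewrite b1 scale1r /l subrr scale0r addr0 gradientD //; last first.
    exact: smooth_on_differentiable (smooth_on_linear a oc) cxp.
  by rewrite gradient_linear gradient_cst addr0.
apply: filterS (nbhs_cod cp) => x cx /=.
by rewrite extend_dom ?paramK //; exact: param_dom.
Qed.

Lemma exists_vector p (v : 'rV[R]_n) : exists X : vector_field M, X p = v.
Proof.
pose c := chart_at p; have cp : dom c p := chart_at_dom p.
have ac : atlas c := chart_at_atlas p; have oc : open (cod c) := open_cod c.
have [b [K [cK Kc b0 b1 sb]]] := chart_cutoff cp.
have su : smooth_mx_on (cod c) (fun x => b x *: v).
  by apply: smooth_mx_onZ => //; [exact: sb|move=> i j; exact: smooth_on_cst].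
have u0 x : ~ K x -> b x *: v = 0 by move=> /b0 ->; rewrite scale0r.
exists (VectorField (smooth_extend_vector ac cK Kc u0 su)) => /=.
by rewrite extend_vector_dom // b1 scale1r jac_id // mulmx1.
Qed.

(* The components are V(x_j) = (V(b x_j) - x_j V(b)) / b, where a cutoff b makes
   b and b x_j global smooth functions. *)
Lemma smooth_vector_derivation (V : M -> 'rV[R]_n) :
  (forall f : smooth_function M, smooth (lie_derivative V f)) -> smooth_vector V.
Proof.
move=> sV c ac i j; rewrite ord1; apply: smooth_on_local => x0 cx0.
have oc : open (cod c) := open_cod c.
have [b [K [cK Kc b0 b1 sb]]] := chart_cutoff (param_dom cx0).
rewrite paramK // in b1.
have sbj : smooth_on (cod c) (fun x => b x * x 0 j).
  by apply: smooth_onM => //; [exact: sb|exact: smooth_on_coord].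
have bj0 x : ~ K x -> b x * x 0 j = 0 by move=> /b0 ->; rewrite mul0r.
pose fb := SmoothFunction (smooth_extend ac cK Kc b0 (sb _ oc)).
pose fj := SmoothFunction (smooth_extend ac cK Kc bj0 sbj).
pose U := cod c `&` b @^-1` [set t | t != 0].
have oU : open U.
  rewrite openE => x [cx bx].
  apply: (@filterI _ (nbhs x) _ (cod c) (b @^-1` [set t | t != 0])).
    by apply: open_nbhs_nbhs.
  exact: cvgr_neq0 (sb setT openT 0%N x I) bx.
have Uc : U `<=` cod c by move=> x [].
exists U; first by split=> //=; rewrite b1 oner_neq0.
have H : smooth_on U (fun x => (lie_derivative V fj (param c x) -
    x 0 j * lie_derivative V fb (param c x)) * (b x)^-1).
  apply: smooth_onM => //; last first.
    by apply: smooth_onV => //; [move=> x []|exact (sb U oU)].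
  apply: smooth_onB => //; first exact: smooth_on_sub Uc (sV fj c ac).
  apply: smooth_onM => //; first exact: smooth_on_coord.
  exact: smooth_on_sub Uc (sV fb c ac).
apply: (smooth_on_eq oU _ H) => x [cx bx].
rewrite !(@lie_derivative_chart _ _ c) //; try exact: sf_smooth;
  try exact: param_dom.
rewrite paramK //.
have near_c u : \near x, (extend c u \o param c) x = u x.
  have : nbhs x (cod c) by exact: open_nbhs_nbhs.
  apply: filterS => y cy /=.
  by rewrite extend_dom ?paramK //; exact: param_dom.
rewrite (gradient_near (near_c b)) (gradient_near (near_c _)).
rewrite gradientM; last 2 first.
- exact: smooth_on_differentiable (sb _ oc) cx.
- exact: smooth_on_differentiable (smooth_on_coord j oc) cx.
rewrite gradient_coord mulmxDr -!scalemxAr -colE !mxE addrK.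
by rewrite mulrC mulKf.
Qed.

(* Cutting [Y] off near [p] makes it a combination of global coordinate fields,
   with coefficients vanishing at [p]. *)
Lemma tensorial_eq0 p (L : vector_field M -> R) :
  (forall X Y, L (vf_add X Y) = L X + L Y) ->
  (forall f X, L (vf_scale f X) = f p * L X) ->
  forall Y : vector_field M, Y p = 0 -> L Y = 0.
Proof.
move=> LD LZ Y Yp.
pose c := chart_at p; have cp : dom c p := chart_at_dom p.
have ac : atlas c := chart_at_atlas p; have oc : open (cod c) := open_cod c.
have [b [K [cK Kc b0 b1 sb]]] := chart_cutoff cp.
have sE i : smooth_mx_on (cod c) (fun x => b x *: (delta_mx 0 i : 'rV[R]_n)).
  by apply: smooth_mx_onZ => //; [exact: sb|move=> k j; exact: smooth_on_cst].
have E0 i x : ~ K x -> b x *: (delta_mx 0 i : 'rV[R]_n) = 0.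
  by move=> /b0 ->; rewrite scale0r.
pose E i := VectorField (smooth_extend_vector ac cK Kc (E0 i) (sE i)).
pose Yc (x : 'rV[R]_n) :=
  Y (param c x) *m jac (chart_at (param c x)) c (param c x).
have sa i : smooth_on (cod c) (fun x => b x * Yc x 0 i).
  by apply: smooth_onM => //; [exact: sb|exact: (vf_smooth Y ac)].
have a0 i x : ~ K x -> b x * Yc x 0 i = 0 by move=> /b0 ->; rewrite mul0r.
pose a i := SmoothFunction (smooth_extend ac cK Kc (a0 i) (sa i)).
(* One factor [b] is spent on the coefficients [a i], the other on the fields [E i], so their
   combination is [b] squared times [Y]. *)
have sbb : smooth_on (cod c) (fun x => b x * b x).
  by apply: smooth_onM => //; exact: sb.
have bb0 x : ~ K x -> b x * b x = 0 by move=> /b0 ->; rewrite mul0r.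
pose bb := SmoothFunction (smooth_extend ac cK Kc bb0 sbb).
pose F i := vf_scale (a i) (E i).
(* Finite sums of fields are built by iterating [vf_add], starting from the zero field written as 0
   times [Y]. *)
have sumF (r : seq 'I_n) : exists S : vector_field M,
    (forall q, S q = \sum_(i <- r) F i q) /\ L S = \sum_(i <- r) L (F i).
  elim: r => [|i r [S [Sq LS]]].
    exists (vf_scale (SmoothFunction (smooth_cst 0)) Y); split=> [q|].
      by rewrite big_nil /= scale0r.
    by rewrite big_nil LZ mul0r.
  exists (vf_add (F i) S); split=> [q|]; first by rewrite big_cons /= Sq.
  by rewrite big_cons LD LS.
have [S [Sq LS]] := sumF (index_enum 'I_n).
have bbY : vf_scale bb Y = S.
  apply: vector_field_ext => q; rewrite Sq /=.
  have [cq|ncq] := pselect (dom c q); last first.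
    rewrite /extend asboolF // scale0r big1 // => i _.
    by rewrite scale0r.
  have chq := chart_at_dom q; have achq := chart_at_atlas q.
  rewrite extend_dom //.
  rewrite (eq_bigr (fun i => (b (coord c q) * b (coord c q)) *:
      ((Yc (coord c q) 0 i *: delta_mx 0 i) *m jac c (chart_at q) q))); last first.
    move=> i _; rewrite /F /= (extend_dom _ cq) (extend_vector_dom _ cq).
    by rewrite -!scalemxAl !scalerA mulrAC.
  rewrite -scaler_sumr -mulmx_suml -row_sum_delta /Yc (coordK cq) -mulmxA.
  by rewrite (jac_comp achq ac achq chq cq chq) (jac_id achq chq) mulmx1.
have : L (vf_scale bb Y) = L Y by rewrite LZ /= extend_dom // b1 !mul1r.
rewrite bbY LS big1 // => i _; rewrite LZ /= extend_dom // /Yc coordK // Yp.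
by rewrite mul0mx mxE mulr0 mul0r.
Qed.

Lemma tensorial_eq p (L : vector_field M -> R) :
  (forall X Y, L (vf_add X Y) = L X + L Y) ->
  (forall f X, L (vf_scale f X) = f p * L X) ->
  forall X Y : vector_field M, X p = Y p -> L X = L Y.
Proof.
move=> LD LZ X Y XY; apply/eqP; rewrite -subr_eq0; apply/eqP.
rewrite -mulN1r.
have <- := LZ (SmoothFunction (smooth_cst (-1))) Y.
by rewrite -LD; apply: tensorial_eq0 LD LZ _ _; rewrite /= XY scaleN1r subrr.
Qed.

(** Since [L] sees only the value at [p], [X] may be replaced by a combination of the [E i] with the
    constant functions [X p 0 i] as coefficients. *)
Lemma tensorial_repr p (L : vector_field M -> R) :
  (forall X Y, L (vf_add X Y) = L X + L Y) ->
  (forall f X, L (vf_scale f X) = f p * L X) ->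
  exists a : 'cV[R]_n, forall X : vector_field M, L X = (X p *m a) 0 0.
Proof.
move=> LD LZ.
have [E Ep] := choice (fun i : 'I_n => exists_vector p (delta_mx 0 i)).
exists (\col_i L (E i)) => X.
have sumF (r : seq 'I_n) : exists S : vector_field M,
    S p = \sum_(i <- r) X p 0 i *: delta_mx 0 i /\
    L S = \sum_(i <- r) X p 0 i * L (E i).
  elim: r => [|i r [S [Sp LS]]].
    exists (vf_scale (SmoothFunction (smooth_cst 0)) X); split.
      by rewrite big_nil /= scale0r.
    by rewrite big_nil LZ mul0r.
  exists (vf_add (vf_scale (SmoothFunction (smooth_cst (X p 0 i))) (E i)) S).
  by rewrite !big_cons /= Ep Sp LD LZ LS.
have [S [Sp LS]] := sumF (index_enum 'I_n).
rewrite (tensorial_eq LD LZ (Y := S)); last by rewrite Sp -row_sum_delta.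
by rewrite LS mxE; apply: eq_bigr => i _; rewrite mxE.
Qed.

End Manifold.

(** * The Koszul formula and Lie brackets *)

Section KoszulArithmetic.
Context {R : realType} {I : Type}.
Variables a b T : I -> I -> I -> R.

(** The common form is [2 * a f h k = T f h k + T k f h - T h f k]: symmetrising it in [f] and [h]
    gives the first identity, in [h] and [k] the second. *)
Lemma symmetric_poisson_koszul :
  (forall f h k, T f h k = T f k h) ->
  (forall f h k, a f h k - a h f k = T f h k - T h f k) ->
  (forall f h k, T k f h = a f h k + a h f k) <->
  (forall f h k, T f h k = a f h k + a f k h).
Proof.
move=> Ts Ta; split=> H f h k.
  have := H f h k; have := H f k h; have := Ta f h k; have := Ta f k h.
  by have := Ts f k h; have := Ts h f k; have := Ts k f h; lra.
have := H k f h; have := H f h k; have := H h f k.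
have := Ta f h k; have := Ta k f h; have := Ta k h f.
by have := Ts f k h; have := Ts h f k; have := Ts k f h; lra.
Qed.

(** The difference [a - b] is symmetric in its first two arguments and skew in its last two, which
    forces it to vanish. *)
Lemma koszul_unique :
  (forall x y z, a x y z + a x z y = b x y z + b x z y) ->
  (forall x y z, a x y z - a y x z = b x y z - b y x z) ->
  forall x y z, a x y z = b x y z.
Proof.
move=> Hc Ht x y z.
have := Hc x y z; have := Hc y z x; have := Hc z x y.
by have := Ht x y z; have := Ht y z x; have := Ht z x y; lra.
Qed.

End KoszulArithmetic.

(* The first-order data at a point [p] that enters the Koszul formula, with
   [kd_metric X Y Z = X(g(Y, Z)) p] and [kd_bracket X Y Z = g([X, Y], Z) p]. *)
Record koszul_data (R : realType) (V S : Type) := KoszulData {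
  kd_add : V -> V -> V;
  kd_scale : S -> V -> V;
  kd_value : S -> R;
  kd_derive : V -> S -> R;
  kd_form : V -> V -> R;
  kd_metric : V -> V -> V -> R;
  kd_bracket : V -> V -> V -> R;
  kd_formC : forall X Y, kd_form X Y = kd_form Y X;
  kd_metricC : forall X Y Z, kd_metric X Y Z = kd_metric X Z Y;
  kd_metricDl : forall X X' Y Z,
    kd_metric (kd_add X X') Y Z = kd_metric X Y Z + kd_metric X' Y Z;
  kd_metricZl : forall f X Y Z,
    kd_metric (kd_scale f X) Y Z = kd_value f * kd_metric X Y Z;
  kd_metricDm : forall X Y Y' Z,
    kd_metric X (kd_add Y Y') Z = kd_metric X Y Z + kd_metric X Y' Z;
  kd_metricZm : forall X f Y Z, kd_metric X (kd_scale f Y) Z =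
    kd_derive X f * kd_form Y Z + kd_value f * kd_metric X Y Z;
  kd_bracketC : forall X Y Z, kd_bracket X Y Z = - kd_bracket Y X Z;
  kd_bracketDm : forall X Y Y' Z,
    kd_bracket X (kd_add Y Y') Z = kd_bracket X Y Z + kd_bracket X Y' Z;
  kd_bracketZm : forall X f Y Z, kd_bracket X (kd_scale f Y) Z =
    kd_derive X f * kd_form Y Z + kd_value f * kd_bracket X Y Z;
  kd_bracketDr : forall X Y Z Z',
    kd_bracket X Y (kd_add Z Z') = kd_bracket X Y Z + kd_bracket X Y Z';
  kd_bracketZr : forall f X Y Z,
    kd_bracket X Y (kd_scale f Z) = kd_value f * kd_bracket X Y Z }.

Section Koszul.
Context {R : realType} {V S : Type} (D : koszul_data R V S).
Implicit Types (X Y Z : V) (f : S).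
Local Notation "X +v Y" := (kd_add D X Y) (at level 50).
Local Notation "f *v X" := (kd_scale D f X) (at level 40).

(** The right-hand side of the Koszul formula for [2 g(nabla_X Y, Z)]. *)
Definition koszul X Y Z : R :=
  kd_metric D X Y Z + kd_metric D Y X Z - kd_metric D Z X Y +
  kd_bracket D X Y Z - kd_bracket D X Z Y - kd_bracket D Y Z X.

Lemma kd_metricDr X Y Z Z' :
  kd_metric D X Y (Z +v Z') = kd_metric D X Y Z + kd_metric D X Y Z'.
Proof. by rewrite !(kd_metricC D X Y) kd_metricDm. Qed.

Lemma kd_metricZr X f Y Z : kd_metric D X Y (f *v Z) =
  kd_derive D X f * kd_form D Y Z + kd_value D f * kd_metric D X Y Z.
Proof. by rewrite !(kd_metricC D X Y) kd_metricZm (kd_formC D Y). Qed.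

Lemma kd_bracketDl X X' Y Z :
  kd_bracket D (X +v X') Y Z = kd_bracket D X Y Z + kd_bracket D X' Y Z.
Proof. by rewrite !(kd_bracketC D _ Y) kd_bracketDm opprD. Qed.

Lemma kd_bracketZl f X Y Z : kd_bracket D (f *v X) Y Z =
  kd_value D f * kd_bracket D X Y Z - kd_derive D Y f * kd_form D X Z.
Proof. by rewrite !(kd_bracketC D _ Y) kd_bracketZm; ring. Qed.

Definition kd_linear := (kd_metricDl, kd_metricZl, kd_metricDm, kd_metricZm,
  kd_metricDr, kd_metricZr, kd_bracketDl, kd_bracketZl, kd_bracketDm,
  kd_bracketZm, kd_bracketDr, kd_bracketZr).

Lemma koszulDr X Y Z Z' : koszul X Y (Z +v Z') = koszul X Y Z + koszul X Y Z'.
Proof. by rewrite /koszul !kd_linear; ring. Qed.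

(** The derivatives of [f] along [X] and along [Y] each occur once in a metric term and once, with
    opposite sign, in a bracket term. *)
Lemma koszulZr f X Y Z : koszul X Y (f *v Z) = kd_value D f * koszul X Y Z.
Proof.
by rewrite /koszul !kd_linear (kd_formC D Z X) (kd_formC D Z Y); ring.
Qed.

Lemma koszulDl X X' Y Z : koszul (X +v X') Y Z = koszul X Y Z + koszul X' Y Z.
Proof. by rewrite /koszul !kd_linear; ring. Qed.

Lemma koszulZl f X Y Z : koszul (f *v X) Y Z = kd_value D f * koszul X Y Z.
Proof. by rewrite /koszul !kd_linear; ring. Qed.

Lemma koszulDm X Y Y' Z : koszul X (Y +v Y') Z = koszul X Y Z + koszul X Y' Z.
Proof. by rewrite /koszul !kd_linear; ring. Qed.

(** Here the derivatives along [X] add up instead of cancelling; halved, the extra term is the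
    Leibniz rule of a connection. *)
Lemma koszulZm f X Y Z : koszul X (f *v Y) Z =
  kd_value D f * koszul X Y Z + 2 * (kd_derive D X f * kd_form D Y Z).
Proof. by rewrite /koszul !kd_linear (kd_formC D X Y); ring. Qed.

Lemma koszul_torsion X Y Z :
  koszul X Y Z - koszul Y X Z = 2 * kd_bracket D X Y Z.
Proof. by rewrite /koszul (kd_bracketC D Y X) (kd_metricC D Z Y X); ring. Qed.

Lemma koszul_metric X Y Z :
  koszul X Y Z + koszul X Z Y = 2 * kd_metric D X Y Z.
Proof.
by rewrite /koszul (kd_bracketC D Z Y) (kd_metricC D X Z Y)
  (kd_metricC D Y X Z) (kd_metricC D Z X Y); ring.
Qed.

End Koszul.

(** With mutually inverse Jacobians for [A] and [B], this says that inversion exchanges the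
    transformation laws of contravariant and covariant 2-tensors. *)
Lemma invmx_congruence (F : fieldType) (n : nat) (A B T : 'M[F]_n) :
  T \in unitmx -> A *m B = 1%:M ->
  invmx (A^T *m T *m A) = B *m invmx T *m B^T.
Proof.
move=> uT AB; have BA := mulmx1C AB.
have [uA _] := mulmx1_unit AB.
have u : A^T *m T *m A \in unitmx by rewrite !unitmx_mul unitmx_tr uA uT.
apply: (can_inj (mulKmx u)); rewrite mulmxV // -!mulmxA (mulmxA A B) AB mul1mx.
by rewrite (mulmxA T) mulmxV // mul1mx -trmx_mul BA trmx1.
Qed.

Section VectorFields.
Context {R : realType} {n : nat} {M : manifold R n}.
Implicit Types (p q : M) (X Y Z : vector_field M) (f h : smooth_function M).

Lemma differential_separates p (v w : 'rV[R]_n) :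
  (forall f, (v *m differential f p) 0 0 = (w *m differential f p) 0 0) -> v = w.
Proof.
move=> vw; apply/rowP => j; have [f fp] := exists_differential p (delta_mx j 0).
by have := vw f; rewrite fp -!colE !mxE.
Qed.

Lemma lie_separates (V W : M -> 'rV[R]_n) p :
  (forall f, lie_derivative V f p = lie_derivative W f p) -> V p = W p.
Proof. exact: differential_separates. Qed.

Lemma lie_oppl (V : M -> 'rV[R]_n) (u : M -> R) p :
  lie_derivative (fun q => - V q) u p = - lie_derivative V u p.
Proof. by rewrite /lie_derivative mulNmx mxE. Qed.

Lemma lie_addl X Y (u : M -> R) p :
  lie_derivative (vf_add X Y) u p = lie_derivative X u p + lie_derivative Y u p.
Proof. by rewrite /lie_derivative mulmxDl mxE. Qed.

Lemma lie_scalel f X (u : M -> R) p :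
  lie_derivative (vf_scale f X) u p = f p * lie_derivative X u p.
Proof. by rewrite /lie_derivative -scalemxAl mxE. Qed.

Lemma lie_addr X (f h : M -> R) p : smooth f -> smooth h ->
  lie_derivative X (fun q => f q + h q) p =
  lie_derivative X f p + lie_derivative X h p.
Proof. by move=> sf sh; rewrite /lie_derivative differentialD // mulmxDr mxE. Qed.

Lemma lie_mulr X (f h : M -> R) p : smooth f -> smooth h ->
  lie_derivative X (fun q => f q * h q) p =
  lie_derivative X f p * h p + f p * lie_derivative X h p.
Proof.
move=> sf sh; rewrite /lie_derivative differentialM // mulmxDr -!scalemxAr !mxE.
by rewrite addrC mulrC.
Qed.

End VectorFields.

(** * Existence and uniqueness of Lie brackets *)

Section LieBracket.
Context {R : realType} {n : nat}.

Lemma gradient_sum (I : Type) (r : seq I) (F : I -> 'rV[R]_n -> R) x :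
  (forall i, differentiable (F i) x) ->
  differentiable (fun y => \sum_(i <- r) F i y) x /\
  gradient (fun y => \sum_(i <- r) F i y) x = \sum_(i <- r) gradient (F i) x.
Proof.
move=> dF; elim: r => [|i r [d1 d2]].
  under eq_fun do rewrite big_nil; rewrite big_nil gradient_cst.
  by split=> //; exact: differentiable_cst.
under eq_fun do rewrite big_cons; rewrite big_cons gradientD // d2; split=> //.
exact: (differentiableD (dF i) d1).
Qed.

Definition directional (X : 'rV[R]_n -> 'rV[R]_n) (F : 'rV[R]_n -> R) y : R :=
  (X y *m gradient F y) 0 0.

(** The second-order part of [directional X (directional Y F)]; its symmetry in [X] and [Y] makes
    the commutator a first-order operator. *)
Definition directional2 (X Y : 'rV[R]_n -> 'rV[R]_n) (F : 'rV[R]_n -> R) x :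
    R :=
  \sum_j \sum_i Y x 0 j * X x 0 i *
      'D_(delta_mx 0 i) ('D_(delta_mx 0 j) F) x.

Lemma directional2_sym U (X Y : 'rV[R]_n -> 'rV[R]_n) F x : open U ->
  smooth_on U F -> U x -> directional2 X Y F x = directional2 Y X F x.
Proof.
move=> oU sF Ux; rewrite /directional2 exchange_big.
apply: eq_bigr => i _; apply: eq_bigr => j _.
by rewrite (derive_symmetric _ _ oU (sF 2%N) Ux) (mulrC (Y x 0 j)).
Qed.

Lemma directional_directional U (X Y : 'rV[R]_n -> 'rV[R]_n) F x : open U ->
  smooth_mx_on U Y -> smooth_on U F -> U x ->
  directional X (directional Y F) x = directional2 X Y F x +
  \sum_j directional X (fun y => Y y 0 j) x * gradient F x j 0.
Proof.
move=> oU sY sF Ux.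
have dY j : differentiable (fun y => Y y 0 j) x.
  exact: smooth_on_differentiable (sY 0 j) Ux.
have dG j : differentiable ('D_(delta_mx 0 j) F) x.
  exact: smooth_on_differentiable (smooth_on_derive _ sF) Ux.
have E : directional Y F = fun y => \sum_j Y y 0 j * 'D_(delta_mx 0 j) F y.
  by apply/funext => y; rewrite /directional mxE;
    apply: eq_bigr => j _; rewrite mxE.
rewrite {1}/directional E.
have [_ ->] := @gradient_sum _ (index_enum 'I_n)
  (fun j y => Y y 0 j * 'D_(delta_mx 0 j) F y) x
  (fun j => differentiableM (dY j) (dG j)).
rewrite mulmx_sumr summxE /directional2 -big_split; apply: eq_bigr => j _ /=.
rewrite gradientM // mulmxDr -!scalemxAr !mxE mulrC; congr (_ + _).
  rewrite mulr_suml; apply: eq_bigr => i _; rewrite mxE; ring.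
by rewrite /directional mxE mulrC.
Qed.

Lemma directional_commutator U (X Y : 'rV[R]_n -> 'rV[R]_n) F x : open U ->
  smooth_mx_on U X -> smooth_mx_on U Y -> smooth_on U F -> U x ->
  directional X (directional Y F) x - directional Y (directional X F) x =
  (\row_j (directional X (fun y => Y y 0 j) x -
           directional Y (fun y => X y 0 j) x) *m gradient F x) 0 0.
Proof.
move=> oU sX sY sF Ux.
rewrite (directional_directional X oU sY sF Ux).
rewrite (directional_directional Y oU sX sF Ux).
rewrite (directional2_sym X Y oU sF Ux).
rewrite opprD addrACA subrr add0r mxE -sumrB.
by apply: eq_bigr => j _; rewrite [X in _ = X * _]mxE mulrBl.
Qed.

Context {M : manifold R n}.
Implicit Types (p q : M) (X Y Z : vector_field M) (f h : smooth_function M).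

Lemma lie_bracket_at X Y p : exists v : 'rV[R]_n, forall f,
  (v *m differential f p) 0 0 =
  vf_apply X (vf_apply Y f) p - vf_apply Y (vf_apply X f) p.
Proof.
pose c := chart_at p; have cp : dom c p := chart_at_dom p.
have ac : atlas c := chart_at_atlas p; have oc : open (cod c) := open_cod c.
have cxp : cod c (coord c p) by exists p.
pose loc (V : vector_field M) x :=
  V (param c x) *m jac (chart_at (param c x)) c (param c x).
have sloc V : smooth_mx_on (cod c) (loc V) := vf_smooth V ac.
have applyE V f x : cod c x ->
    vf_apply V f (param c x) = directional (loc V) (f \o param c) x.
  move=> cx; rewrite /= (lie_derivative_chart _ (sf_smooth f) ac (param_dom cx)).
  by rewrite paramK.
have applyE2 V W f :
    vf_apply V (vf_apply W f) p =
    directional (loc V) (directional (loc W) (f \o param c)) (coord c p).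
  have E := applyE V (vf_apply W f) (coord c p) cxp.
  rewrite (coordK cp) in E.
  apply: (etrans E).
  apply: (congr1 (fun a => (loc V (coord c p) *m a) 0 0)); apply: gradient_near.
  by apply: filterS (nbhs_cod cp) => x cx; exact: applyE.
have [v Hv] : exists v : 'rV[R]_n, forall f : smooth_function M,
    directional (loc X) (directional (loc Y) (f \o param c)) (coord c p) -
    directional (loc Y) (directional (loc X) (f \o param c)) (coord c p) =
    (v *m gradient (f \o param c) (coord c p)) 0 0.
  (* The witness is the row of the X(Y_j) - Y(X_j), which does not involve [f]. As [c] is the chart
     chosen at [p], it is already a tangent vector at [p]. *)
  eexists => f; apply: (directional_commutator oc) => //.
  exact: (sf_smooth f ac).
by exists v => f; rewrite !applyE2 Hv.
Qed.

Lemma lie_bracket_exists X Y : exists Z : vector_field M, is_lie_bracket X Y Z.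
Proof.
have [V HV] := choice (lie_bracket_at X Y).
have sV f : smooth (lie_derivative V f).
  have -> : lie_derivative V f = (fun p => vf_apply X (vf_apply Y f) p +
      -1 * vf_apply Y (vf_apply X f) p).
    by apply/funext => p; rewrite mulN1r; exact: HV.
  apply: smoothD; first exact: sf_smooth.
  by apply: smoothM; [exact: smooth_cst|exact: sf_smooth].
by exists (VectorField (smooth_vector_derivation sV)) => f p; exact: HV.
Qed.

Lemma lie_bracket_unique X Y (Z Z' : M -> 'rV[R]_n) p :
  is_lie_bracket X Y Z -> is_lie_bracket X Y Z' -> Z p = Z' p.
Proof.
move=> HZ HZ'; apply: differential_separates => f.
exact: etrans (HZ f p) (esym (HZ' f p)).
Qed.

End LieBracket.

(** * The fundamental theorem of Riemannian geometry *)

Section FormPairing.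
Context {R : realType} {n : nat} {M : manifold R n}.
Variable g : M -> 'M[R]_n.
Implicit Types (p q : M) (u v w : 'rV[R]_n) (a : R).

Lemma form_pairingDl p u v w :
  form_pairing g p (u + v) w = form_pairing g p u w + form_pairing g p v w.
Proof. by rewrite /form_pairing !mulmxDl mxE. Qed.

Lemma form_pairingZl p a v w :
  form_pairing g p (a *: v) w = a * form_pairing g p v w.
Proof. by rewrite /form_pairing -!scalemxAl mxE. Qed.

Lemma form_pairingNl p v w : form_pairing g p (- v) w = - form_pairing g p v w.
Proof. by rewrite -scaleN1r form_pairingZl mulN1r. Qed.

Lemma form_pairingC p v w : (g p)^T = g p ->
  form_pairing g p v w = form_pairing g p w v.
Proof.
move=> gs; transitivity ((w *m g p *m v^T)^T 0 0); last by rewrite mxE.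
by rewrite !trmx_mul trmxK gs mulmxA.
Qed.

Lemma bijective_flat_unitmx p : bijective (flat g p) -> g p \in unitmx.
Proof.
move=> /bij_inj inj; rewrite -row_free_unit -kermx_eq0.
apply/eqP/row_matrixP => i; rewrite row0; apply: inj.
by rewrite /flat -row_mul mulmx_ker row0 mul0mx.
Qed.

Lemma unitmx_bijective_flat p : g p \in unitmx -> bijective (flat g p).
Proof.
move=> u; exists (fun z => z^T *m invmx (g p)) => z; rewrite /flat.
  by rewrite trmxK mulmxK.
by rewrite mulmxKV // trmxK.
Qed.

Lemma smooth_form_pairing (Y Z : vector_field M) : smooth_covariant2 g ->
  smooth (fun p => form_pairing g p (Y p) (Z p)).
Proof.
move=> sg c ac; have oc : open (cod c) := open_cod c.
have H := smooth_mx_onM oc (smooth_mx_onM oc (vf_smooth Y ac) (sg c ac))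
  (smooth_mx_on_tr oc (vf_smooth Z ac)).
apply: (smooth_on_eq oc _ (H 0 0)) => x cx /=.
set p := param c x; have cp : dom c p := param_dom cx.
have J : jac (chart_at p) c p *m jac c (chart_at p) p = 1%:M.
  have ap := chart_at_atlas p; have dp := chart_at_dom p.
  by rewrite (jac_comp ap ac ap dp cp dp) (jac_id ap dp).
rewrite /form_pairing; congr (_ 0 0).
rewrite -/p -!mulmxA (mulmxA (jac (chart_at p) c p)) J mul1mx.
by rewrite -trmx_mul -mulmxA J mulmx1.
Qed.

End FormPairing.

Section LeviCivita.
Context {R : realType} {n : nat} {M : manifold R n}.
Variable g : M -> 'M[R]_n.
Hypothesis g_smooth : smooth_covariant2 g.
Hypothesis g_sym : forall p, (g p)^T = g p.
Hypothesis g_unit : forall p, g p \in unitmx.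
Implicit Types (p q : M) (X Y Z : vector_field M) (f h : smooth_function M).

Definition pairing Y Z : M -> R := fun p => form_pairing g p (Y p) (Z p).

Lemma smooth_pairing Y Z : smooth (pairing Y Z).
Proof. exact: smooth_form_pairing. Qed.

Lemma pairingC Y Z : pairing Y Z = pairing Z Y.
Proof. by apply/funext => p; exact: form_pairingC. Qed.

Lemma pairingDl Y Y' Z p :
  pairing (vf_add Y Y') Z p = pairing Y Z p + pairing Y' Z p.
Proof. exact: form_pairingDl. Qed.

Lemma pairingZl f Y Z p : pairing (vf_scale f Y) Z p = f p * pairing Y Z p.
Proof. exact: form_pairingZl. Qed.

Lemma lie_pairingDl X Y Y' Z p :
  lie_derivative X (pairing (vf_add Y Y') Z) p =
  lie_derivative X (pairing Y Z) p + lie_derivative X (pairing Y' Z) p.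
Proof.
rewrite -lie_addr; try exact: smooth_pairing.
by congr lie_derivative; apply/funext => q; exact: pairingDl.
Qed.

Lemma lie_pairingZl X f Y Z p :
  lie_derivative X (pairing (vf_scale f Y) Z) p =
  lie_derivative X f p * pairing Y Z p + f p * lie_derivative X (pairing Y Z) p.
Proof.
rewrite -lie_mulr; [|exact: sf_smooth|exact: smooth_pairing].
by congr lie_derivative; apply/funext => q; exact: pairingZl.
Qed.

Lemma form_pairing_separates p (v w : 'rV[R]_n) :
  (forall Z, form_pairing g p v (Z p) = form_pairing g p w (Z p)) -> v = w.
Proof.
move=> vw; apply: (can_inj (mulmxK (g_unit p))); apply/rowP => j.
have [Z Zp] := exists_vector p (delta_mx 0 j : 'rV[R]_n).
by have := vw Z; rewrite /form_pairing Zp trmx_delta -!colE !mxE.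
Qed.

Lemma levi_civita_unique (D D' : connection M) X Y p :
  levi_civita g D -> levi_civita g D' -> D X Y p = D' X Y p.
Proof.
move=> [tD cD] [tD' cD']; apply: (form_pairing_separates (p := p)) => Z.
apply: (koszul_unique (a := fun X Y Z => form_pairing g p (D X Y p) (Z p))
  (b := fun X Y Z => form_pairing g p (D' X Y p) (Z p))) => {X Y Z} X Y Z.
  rewrite (form_pairingC (D X Z p)) // (form_pairingC (D' X Z p)) //.
  by rewrite -cD -cD'.
have /= E := lie_bracket_unique p (tD X Y) (tD' X Y).
by rewrite -!form_pairingNl -!form_pairingDl E.
Qed.

Definition lie_bracket X Y : vector_field M :=
  projT1 (cid (lie_bracket_exists X Y)).

Lemma lie_bracketP X Y : is_lie_bracket X Y (lie_bracket X Y).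
Proof. by rewrite /lie_bracket; case: cid. Qed.

Lemma lie_bracketE X Y f p : lie_derivative (lie_bracket X Y) f p =
  lie_derivative X (lie_derivative Y f) p - lie_derivative Y (lie_derivative X f) p.
Proof. exact: lie_bracketP. Qed.

Lemma lie_bracketC X Y p : lie_bracket X Y p = - lie_bracket Y X p.
Proof.
apply: (@lie_separates _ _ _ (lie_bracket X Y)
  (fun q => - lie_bracket Y X q)) => f.
by rewrite lie_oppl !lie_bracketE opprB.
Qed.

Lemma lie_bracketDr X Y Y' p :
  lie_bracket X (vf_add Y Y') p = lie_bracket X Y p + lie_bracket X Y' p.
Proof.
apply: (@lie_separates _ _ _ (lie_bracket X (vf_add Y Y'))
  (vf_add (lie_bracket X Y) (lie_bracket X Y'))) => f.
rewrite lie_addl !lie_bracketE lie_addl.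
have -> : lie_derivative (vf_add Y Y') f =
    (fun q => lie_derivative Y f q + lie_derivative Y' f q).
  by apply/funext => q; exact: lie_addl.
rewrite lie_addr; try exact: vf_apply_smooth.
by rewrite opprD addrACA.
Qed.

Lemma lie_bracketZr X f Y p : lie_bracket X (vf_scale f Y) p =
  lie_derivative X f p *: Y p + f p *: lie_bracket X Y p.
Proof.
apply: (@lie_separates _ _ _ (lie_bracket X (vf_scale f Y))
  (vf_add (vf_scale (vf_apply X f) Y) (vf_scale f (lie_bracket X Y)))) => h.
rewrite lie_addl !lie_scalel !lie_bracketE lie_scalel.
have -> : lie_derivative (vf_scale f Y) h = (fun q => f q * lie_derivative Y h q).
  by apply/funext => q; exact: lie_scalel.
rewrite lie_mulr; [|exact: sf_smooth|exact: vf_apply_smooth].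
by rewrite mulrBr addrA.
Qed.

Definition koszul_at p : koszul_data R (vector_field M) (smooth_function M).
Proof.
refine (@KoszulData R (vector_field M) (smooth_function M) vf_add vf_scale
  (fun f => f p) (fun X f => lie_derivative X f p)
  (fun Y Z => pairing Y Z p) (fun X Y Z => lie_derivative X (pairing Y Z) p)
  (fun X Y Z => pairing (lie_bracket X Y) Z p) _ _ _ _ _ _ _ _ _ _ _).
- by move=> Y Z; rewrite pairingC.
- by move=> X Y Z; rewrite (pairingC Y Z).
- by move=> *; exact: lie_addl.
- by move=> *; exact: lie_scalel.
- by move=> *; exact: lie_pairingDl.
- by move=> *; exact: lie_pairingZl.
- by move=> X Y Z; rewrite /pairing lie_bracketC form_pairingNl.
- by move=> *; rewrite /pairing lie_bracketDr form_pairingDl.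
- by move=> *; rewrite /pairing lie_bracketZr form_pairingDl !form_pairingZl.
- by move=> X Y Z Z'; rewrite !(pairingC (lie_bracket X Y)) pairingDl.
- by move=> f X Y Z; rewrite !(pairingC (lie_bracket X Y)) pairingZl.
Defined.

Lemma smooth_koszul X Y Z : smooth (fun p => koszul (koszul_at p) X Y Z).
Proof.
have sL X' Y' Z' : smooth (lie_derivative X' (pairing Y' Z')).
  exact: (vf_apply_smooth X' (SmoothFunction (smooth_pairing Y' Z'))).
have sN (f : M -> R) : smooth f -> smooth (fun p => - f p).
  move=> sf c ac; have oc : open (cod c) := open_cod c.
  have H := smooth_onM oc (smooth_on_cst (cod c) (-1 : R)) (sf c ac).
  by apply: (smooth_on_eq oc _ H) => x _; rewrite mulN1r.
rewrite /koszul /=.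
apply: smoothD; last by apply: sN; exact: smooth_pairing.
apply: smoothD; last by apply: sN; exact: smooth_pairing.
apply: smoothD; last exact: smooth_pairing.
apply: smoothD; last by apply: sN; exact: sL.
by apply: smoothD; exact: sL.
Qed.

Lemma smooth_inverse_metric : smooth_contravariant2 (fun p => invmx (g p)).
Proof.
move=> c ac; have oc : open (cod c) := open_cod c.
pose G x := let p := param c x in
  jac c (chart_at p) p *m g p *m (jac c (chart_at p) p)^T.
have J x : cod c x -> let p := param c x in
    jac c (chart_at p) p *m jac (chart_at p) c p = 1%:M.
  move=> cx p; have cp : dom c p := param_dom cx.
  have ap := chart_at_atlas p; have dp := chart_at_dom p.
  by rewrite (jac_comp ac ap ac cp dp cp) (jac_id ac cp).
have uG x : cod c x -> G x \in unitmx.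
  move=> /J /mulmx1_unit[uJ _].
  by rewrite /G !unitmx_mul unitmx_tr uJ g_unit.
have H := smooth_mx_on_inv oc uG (g_smooth ac).
apply: (smooth_mx_on_eq oc _ H) => x cx.
have /= Jx := J x cx; rewrite /G /= -[X in X *m g _ *m _]trmxK.
have JT : (jac c (chart_at (param c x)) (param c x))^T^T *m
    jac (chart_at (param c x)) c (param c x) = 1%:M by rewrite trmxK.
have JT' : (jac c (chart_at (param c x)) (param c x))^T *m
    (jac (chart_at (param c x)) c (param c x))^T = 1%:M.
  by rewrite -trmx_mul (mulmx1C Jx) trmx1.
by rewrite (invmx_congruence (g_unit _) JT') trmxK.
Qed.

Lemma inverse_metric_sym p : (invmx (g p))^T = invmx (g p).
Proof. by rewrite trmx_inv g_sym. Qed.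

Definition inverse_metric : symmetric_bivector M :=
  SymmetricBivector inverse_metric_sym smooth_inverse_metric.

Lemma koszul_field_at X Y p : exists v : 'rV[R]_n, forall Z,
  form_pairing g p v (Z p) = 2^-1 * koszul (koszul_at p) X Y Z.
Proof.
have [a La] := @tensorial_repr _ _ _ p (koszul (koszul_at p) X Y)
  (koszulDr (koszul_at p) X Y) (fun f => koszulZr (koszul_at p) f X Y).
(* The covector [a] with its index raised by [g], halved because [koszul] stands for twice the
   pairing. *)
exists (2^-1 *: (a^T *m invmx (g p))) => Z.
rewrite form_pairingZl La; congr (_ * _).
rewrite /form_pairing mulmxKV //.
by rewrite -trmx_mul mxE.
Qed.

Lemma koszul_field_exists X Y : exists V : vector_field M, forall Z p,
  form_pairing g p (V p) (Z p) = 2^-1 * koszul (koszul_at p) X Y Z.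
Proof.
have [V HV] := choice (koszul_field_at X Y).
have sV f : smooth (lie_derivative V f).
  (* [hamiltonian inverse_metric f] is the gradient of [f], so V(f) is the pairing of [V] with it: a
     Koszul expression in smooth fields. *)
  have -> : lie_derivative V f = (fun p => 2^-1 *
      koszul (koszul_at p) X Y (hamiltonian inverse_metric f)).
    apply/funext => p; rewrite -HV /form_pairing /= /sharp.
    by rewrite trmx_mul trmxK inverse_metric_sym !mulmxA mulmxK.
  by apply: smoothM; [exact: smooth_cst|exact: smooth_koszul].
by exists (VectorField (smooth_vector_derivation sV)) => Z p; exact: HV.
Qed.

Lemma levi_civita_exists : exists D : connection M, levi_civita g D.
Proof.
(* The field is chosen separately for each pair; its pairings determine it, so every axiom of a
   connection reduces to the corresponding rule for [koszul]. *)
have [N' HN'] := choice (fun XY => koszul_field_exists XY.1 XY.2).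
pose N X Y := N' (X, Y).
have HN X Y Z p : form_pairing g p (N X Y p) (Z p) =
    2^-1 * koszul (koszul_at p) X Y Z := HN' (X, Y) Z p.
have NDl X Y Z : N (vf_add X Y) Z = vf_add (N X Z) (N Y Z).
  apply: vector_field_ext => p; apply: (form_pairing_separates (p := p)) => W.
  rewrite HN (koszulDl (koszul_at p)) mulrDr -!HN.
  exact: esym (form_pairingDl _ _ _ _ _).
have NZl f X Y : N (vf_scale f X) Y = vf_scale f (N X Y).
  apply: vector_field_ext => p; apply: (form_pairing_separates (p := p)) => W.
  rewrite HN (koszulZl (koszul_at p)) mulrCA -HN.
  exact: esym (form_pairingZl _ _ _ _ _).
have NDr X Y Z : N X (vf_add Y Z) = vf_add (N X Y) (N X Z).
  apply: vector_field_ext => p; apply: (form_pairing_separates (p := p)) => W.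
  apply: (etrans (HN _ _ _ _)).
  apply: etrans (congr1 _ (koszulDm (koszul_at p) X Y Z W)) _.
  rewrite mulrDr -(HN X Y) -(HN X Z).
  exact: esym (form_pairingDl _ _ _ _ _).
have NL X f Y : N X (vf_scale f Y) =
    vf_add (vf_scale (vf_apply X f) Y) (vf_scale f (N X Y)).
  apply: vector_field_ext => p; apply: (form_pairing_separates (p := p)) => W.
  rewrite HN (koszulZm (koszul_at p)) mulrDr mulrCA -HN mulKf ?pnatr_eq0 //.
  by rewrite /= form_pairingDl !form_pairingZl addrC.
exists (Connection NDl NZl NDr NL); split.
  move=> X Y; have -> : (fun p => N X Y p - N Y X p) = lie_bracket X Y.
    apply/funext => p; apply: (form_pairing_separates (p := p)) => Z.
    rewrite form_pairingDl form_pairingNl !HN -mulrBr koszul_torsion.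
    by rewrite mulKf ?pnatr_eq0.
  exact: lie_bracketP.
move=> X Y Z p /=; rewrite (form_pairingC (Y p)) // !HN -mulrDr koszul_metric.
by rewrite mulKf ?pnatr_eq0.
Qed.

(** The value of [(nabla_X g)(Y, Z)] at [p]. *)
Definition metric_defect (D : connection M) p X Y Z : R :=
  lie_derivative X (pairing Y Z) p - pairing (D X Y) Z p - pairing (D X Z) Y p.

Lemma metric_defectC D p X Y Z :
  metric_defect D p X Y Z = metric_defect D p X Z Y.
Proof. by rewrite /metric_defect (pairingC Y Z) addrAC. Qed.

Lemma metric_defect_eql D p X X' Y Z :
  X p = X' p -> metric_defect D p X Y Z = metric_defect D p X' Y Z.
Proof.
apply: (tensorial_eq (L := fun X => metric_defect D p X Y Z))
  => [{}X {}X'|f {}X].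
  rewrite /metric_defect lie_addl !nablaDl (pairingDl (D X Y)).
  by rewrite (pairingDl (D X Z)); ring.
rewrite /metric_defect lie_scalel !nablaZl (pairingZl f (D X Y)).
by rewrite (pairingZl f (D X Z)); ring.
Qed.

Lemma metric_defect_eqm D p X Y Y' Z :
  Y p = Y' p -> metric_defect D p X Y Z = metric_defect D p X Y' Z.
Proof.
apply: (tensorial_eq (L := fun Y => metric_defect D p X Y Z))
  => [{}Y {}Y'|f {}Y].
  rewrite /metric_defect lie_pairingDl nablaDr (pairingDl (D X Y)).
  by rewrite (pairingC (D X Z)) (pairingDl Y) !(pairingC _ (D X Z)); ring.
(* The term (Xf) g(Y, Z) comes once from differentiating the metric and once from the Leibniz rule
   of [D], and cancels. *)
rewrite /metric_defect lie_pairingZl nabla_leibniz.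
rewrite (pairingDl (vf_scale (vf_apply X f) Y)) (pairingZl (vf_apply X f) Y).
rewrite (pairingZl f (D X Y)) (pairingC (D X Z))
  (pairingZl f Y) (pairingC Y (D X Z)).
by rewrite /=; ring.
Qed.

Lemma metric_compatibleP D :
  metric_compatible g D <-> forall p X Y Z, metric_defect D p X Y Z = 0.
Proof.
split=> [H p X Y Z|H X Y Z p].
  have E : lie_derivative X (pairing Y Z) p =
    pairing (D X Y) Z p + pairing Y (D X Z) p := H X Y Z p.
  by rewrite /metric_defect (pairingC (D X Z)) E; ring.
apply: subr0_eq; rewrite opprD addrA.
by have := H p X Y Z; rewrite /metric_defect (pairingC (D X Z)).
Qed.

End LeviCivita.

(** * Strong symmetric Poisson structures *)

Section StrongSymmetricPoisson.
Context {R : realType} {n : nat} {M : manifold R n}.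
Variable theta : symmetric_bivector M.
Hypothesis theta_nondeg : nondegenerate_bivector theta.
Implicit Types (p : M) (f h k : smooth_function M).
Let g := inverse_form theta.
Let X_ := hamiltonian theta.

Lemma inverse_form_sym p : (g p)^T = g p.
Proof. by rewrite /g /inverse_form trmx_inv sb_sym. Qed.

Lemma inverse_form_unit p : g p \in unitmx.
Proof. by rewrite unitmx_inv; exact: nondegenerate_unitmx. Qed.

Lemma smooth_inverse_form : smooth_covariant2 g.
Proof.
move=> c ac; have oc : open (cod c) := open_cod c.
have J x : cod c x -> let p := param c x in
    jac (chart_at p) c p *m jac c (chart_at p) p = 1%:M.
  move=> cx p; have cp : dom c p := param_dom cx.
  have ap := chart_at_atlas p; have dp := chart_at_dom p.
  by rewrite (jac_comp ap ac ap dp cp dp) (jac_id ap dp).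
have uT x : cod c x -> (let p := param c x in
    (jac (chart_at p) c p)^T *m theta p *m jac (chart_at p) c p) \in unitmx.
  move=> /J /= /mulmx1_unit[uJ _].
  rewrite !unitmx_mul unitmx_tr uJ andbT /=.
  exact: nondegenerate_unitmx.
have H := smooth_mx_on_inv oc uT (sb_smooth theta ac).
apply: (smooth_mx_on_eq oc _ H) => x cx.
exact: invmx_congruence (nondegenerate_unitmx _ theta_nondeg) (J x cx).
Qed.

Lemma bivector_pairingC p (a b : 'cV[R]_n) :
  bivector_pairing theta p a b = bivector_pairing theta p b a.
Proof.
transitivity ((b^T *m theta p *m a)^T 0 0); last by rewrite mxE.
by rewrite !trmx_mul trmxK sb_sym mulmxA.
Qed.

Lemma bracketC f h : bracket theta f h = bracket theta h f :> (M -> R).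
Proof. by apply/funext => p; exact: bivector_pairingC. Qed.

Lemma form_pairing_hamiltonian p v h :
  form_pairing g p v (X_ h p) = (v *m differential h p) 0 0.
Proof.
rewrite /form_pairing /= /sharp trmx_mul trmxK sb_sym mulmxA mulmxKV //.
exact: nondegenerate_unitmx.
Qed.

Lemma pairing_hamiltonian f h : pairing g (X_ f) (X_ h) = bracket theta f h.
Proof. by apply/funext => p; exact: form_pairing_hamiltonian. Qed.

Lemma exists_hamiltonian p (v : 'rV[R]_n) : exists f, X_ f p = v.
Proof.
have [f fp] := exists_differential p (flat g p v).
by exists f; rewrite /= fp; exact: flatK.
Qed.

Lemma strong_symmetric_poissonP (D : connection M) : torsion_free D ->
  strong_symmetric_poisson theta D <-> levi_civita g D.
Proof.
move=> tD.
(* This is A(f,h;k), since pairing a vector [v] with [X_ k] under [g] gives dk(v). *)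
pose a p f h k := lie_derivative (D (X_ f) (X_ h)) k p.
pose T p f h k := lie_derivative (X_ f) (bracket theta h k) p.
have Ts p f h k : T p f h k = T p f k h by rewrite /T bracketC.
have Ta p f h k : a p f h k - a p h f k = T p f h k - T p h f k.
  (* [X_ h] applied to [k] is {h,k} by definition, so this is torsion-freeness evaluated on [k]. *)
  by rewrite -[RHS](tD (X_ f) (X_ h) k p) /a /lie_derivative mulmxBl !mxE.
have koszulP p := symmetric_poisson_koszul (Ts p) (Ta p).
have poissonP : strong_symmetric_poisson theta D <->
    forall p f h k, T p k f h = a p f h k + a p h f k.
  (* Symmetry of [theta] turns X_k{f,h} into dk evaluated on the Hamiltonian field of {f,h}.
     Differentials separate tangent vectors, so testing on all [k] is equivalent to the identity of
     fields. *)
  have E p f h k : T p k f h = lie_derivative (X_ (bracket theta f h)) k p.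
    exact: bivector_pairingC.
  split=> [[_ H] p f h k|H].
    by rewrite E [X_ _]H lie_addl.
  split=> // f h; apply: vector_field_ext => p.
  apply: lie_separates => k.
  by rewrite -E H lie_addl.
have metricP : levi_civita g D <->
    forall p f h k, T p f h k = a p f h k + a p f k h.
  have E p f h k : metric_defect g D p (X_ f) (X_ h) (X_ k) =
      T p f h k - a p f h k - a p f k h.
    rewrite /metric_defect pairing_hamiltonian.
    congr (_ - _ - _); exact: form_pairing_hamiltonian.
  split=> [[_ /(metric_compatibleP inverse_form_sym) H] p f h k|H].
    by apply: subr0_eq; rewrite opprD addrA -E.
  split=> //; apply/(metric_compatibleP inverse_form_sym) => p X Y Z.
  have [f fX] := exists_hamiltonian p (X p).
  have [h hY] := exists_hamiltonian p (Y p).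
  have [k kZ] := exists_hamiltonian p (Z p).
  have sg := smooth_inverse_form; have gs := inverse_form_sym.
  rewrite (metric_defect_eql g D Y Z (esym fX)).
  rewrite (metric_defect_eqm sg gs D (X_ f) Z (esym hY)).
  rewrite (metric_defectC gs) (metric_defect_eqm sg gs D (X_ f) (X_ h) (esym kZ)).
  by rewrite (metric_defectC gs) E H; ring.
apply: (iff_trans poissonP); apply: iff_sym; apply: (iff_trans metricP).
split=> H p; [exact (proj2 (koszulP p) (H p))|exact (proj1 (koszulP p) (H p))].
Qed.

End StrongSymmetricPoisson.

Lemma connection_ext (R : realType) (n : nat) (M : manifold R n)
    (D D' : connection M) : (forall X Y p, D X Y p = D' X Y p) -> D = D'.
Proof.
case: D D' => N h1 h2 h3 h4 [N' h1' h2' h3' h4'] /= NN.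
have E : N = N'.
  apply/funext => X; apply/funext => Y.
  by apply: vector_field_ext => p; exact: NN.
case: N' / E h1' h2' h3' h4' {NN} => *.
by congr Connection; exact: Prop_irrelevance.
Qed.

Lemma symmetric_bivector_ext (R : realType) (n : nat) (M : manifold R n)
    (theta eta : symmetric_bivector M) : (forall p, theta p = eta p) -> theta = eta.
Proof.
case: theta eta => t ts tm [e es em] /= /funext te.
case: e / te es em => *.
by congr SymmetricBivector; exact: Prop_irrelevance.
Qed.

Theorem proposition3p12 (R : realType) (n : nat) (M : manifold R n) :
  (forall (theta : symmetric_bivector M) (D : connection M),
     nondegenerate_bivector theta -> torsion_free D ->
     (strong_symmetric_poisson theta D <-> levi_civita (inverse_form theta) D)) /\
  set_bij
    [set S : symmetric_bivector M * connection M |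
       nondegenerate_bivector S.1 /\ strong_symmetric_poisson S.1 S.2]
    [set g : M -> 'M[R]_n | pseudo_riemannian_metric g]
    (fun S => inverse_form S.1).
Proof.
split=> [theta D nd tD|]; first exact: strong_symmetric_poissonP.
split.
- move=> [theta D] /= [nd _]; split.
  + exact: smooth_inverse_form.
  + exact: inverse_form_sym.
  + by move=> p; apply: unitmx_bijective_flat; exact: inverse_form_unit.
- move=> [theta D] [eta E]; rewrite !inE /= => -[nt pt] [ne pe] te.
  have {te} te : theta = eta.
    (* [invmx] fixes non-invertible matrices, hence is an involution of all matrices and
       injective. *)
    apply: symmetric_bivector_ext => p; apply: (can_inj (@invmxK _ _)).
    exact (congr1 (fun g : M -> 'M[R]_n => g p) te).
  case: eta / te ne pe => _ pe; congr pair.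
  have tD := pt.1; have tE := pe.1.
  move/(strong_symmetric_poissonP nt tD) in pt.
  move/(strong_symmetric_poissonP nt tE) in pe.
  apply: connection_ext => X Y p.
  by apply: (levi_civita_unique _ _ X Y p pt pe) => q;
    [exact: inverse_form_sym|exact: inverse_form_unit].
- move=> g [sg gs gb].
  have gu p : g p \in unitmx by exact: bijective_flat_unitmx.
  have [D lD] := levi_civita_exists sg gs gu.
  pose theta := inverse_metric sg gs gu.
  have tg : inverse_form theta = g.
    by apply/funext => p; rewrite /inverse_form /= invmxK.
  have nt : nondegenerate_bivector theta.
    move=> p; exists (flat (inverse_form theta) p).
      move=> a; rewrite /flat /sharp /inverse_form mulmxK ?trmxK //.
      by rewrite /= unitmx_inv.
    move=> v; rewrite /flat /sharp /inverse_form trmxK mulmxKV //.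
    by rewrite /= unitmx_inv.
  exists (theta, D) => //=; split=> //.
  apply/(strong_symmetric_poissonP nt); first by case: lD.
  by rewrite tg.
Qed.
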